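(* Suppose $\alpha\in\Bbbk\setminus\{0,1,-1\}$. Let $i$ be a square root of $-1$. (1) $A(\alpha,1,-1)$ is a Sklyanin algebra $A(E,\tau)$ with $\tau$ being translation by a $4$-torsion point. (2) There is a basis $Y_+,Y_-,K,K'$ for the degree-one component $A(\alpha,1,-1)_1$ such that $$KY_\pm=\mp iY_\pm K,\qquad K'Y_\pm=\pm iY_\pm K',$$ $$[Y_+,Y_-]=i(K'^2-K^2),\qquad [K,K']=i\alpha(Y_+^2-Y_-^2).$$
   Context: $\Bbbk$ is a field of characteristic not $2$ containing a square root of $-1$; parameters of the algebras $A(\alpha,\beta,\gamma)$ are assumed to have square roots in $\Bbbk$. Write $[x,y]=xy-yx$, $\{x,y\}=xy+yx$. $A(\alpha,\beta,\gamma)$ is the free algebra $\Bbbk\langle x_0,x_1,x_2,x_3\rangle$ (graded, $\deg x_j=1$) modulo $$[x_0,x_1]=\alpha\{x_2,x_3\},\quad [x_0,x_2]=\beta\{x_3,x_1\},\quad [x_0,x_3]=\gamma\{x_1,x_2\},$$ $$\{x_0,x_1\}=[x_2,x_3],\quad \{x_0,x_2\}=[x_3,x_1],\quad \{x_0,x_3\}=[x_1,x_2];$$ it is a ($4$-dimensional) Sklyanin algebra if $\alpha+\beta+\gamma+\alpha\beta\gamma=0$. Let $V$ be the span of the $x_j$ and $R\subseteq V\otimes V$ the space of quadratic relations, so $A(\alpha,\beta,\gamma)=TV/(R)$; view elements of $V\otimes V$ as $(1,1)$-forms on $\mathbb P(V^* )\times\mathbb P(V^* )$ and let $\Gamma$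 be the scheme-theoretic zero locus of $R$. The notation $A(E,\tau)$ for a Sklyanin algebra means that $E\subseteq\mathbb P(V^* )=\mathbb P^3$ is a quartic elliptic curve, $\tau:E\to E$ is a translation automorphism, and $\Gamma$ is the graph of an automorphism of $E\cup\{e_0,e_1,e_2,e_3\}$, where $e_0=(1,0,0,0),\dots,e_3=(0,0,0,1)$, that fixes each $e_j$ and restricts to $\tau$ on $E$. *)

(* Defs.v *)
From HB Require Import structures.
From mathcomp Require Import all_boot all_order all_algebra.
From mathcomp.multinomials Require Import monalg.
From mathcomp.multinomials Require Import mpoly.

Set Implicit Arguments.
Unset Strict Implicit.
Unset Printing Implicit Defensive.

Import GRing.Theory.
Local Open Scope ring_scope.

(** * The algebras A(alpha, beta, gamma) *)

(** k<x_0, x_1, x_2, x_3>, as the monoid algebra of the free monoid on 'I_4. *)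
Notation freealg k := (@monalg.malg (monalg.fmonom 'I_4) k).

Section Algebra.
Variable k : fieldType.
Implicit Types (a b c : freealg k) (alpha beta gamma : k).

Definition word (s : seq 'I_4) : monalg.fmonom 'I_4 := monalg.FMonom s.

Definition gen (j : 'I_4) : freealg k := monalg.mkmalgU (word [:: j]) 1.

Definition x0 := gen (inord 0).
Definition x1 := gen (inord 1).
Definition x2 := gen (inord 2).
Definition x3 := gen (inord 3).

Definition comm a b := a * b - b * a.
Definition anti a b := a * b + b * a.

Definition relations alpha beta gamma : seq (freealg k) :=
  [:: comm x0 x1 - alpha *: anti x2 x3;
      comm x0 x2 - beta *: anti x3 x1;
      comm x0 x3 - gamma *: anti x1 x2;
      anti x0 x1 - comm x2 x3;
      anti x0 x2 - comm x3 x1;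
      anti x0 x3 - comm x1 x2].

(** Membership in the two-sided ideal generated by [S]. *)
Definition in_ideal (S : seq (freealg k)) a : Prop :=
  exists s : seq (freealg k * freealg k * freealg k),
    (forall t, t \in s -> t.1.2 \in S) /\
    a = \sum_(t <- s) t.1.1 * t.1.2 * t.2.

(** Elements of A(alpha, beta, gamma) are represented in the free algebra;
    [eqA] is equality of their classes. *)
Definition eqA alpha beta gamma a b : Prop :=
  in_ideal (relations alpha beta gamma) (a - b).

Definition degree_one a : Prop :=
  forall w, monalg.mcoeff w a != 0 -> monalg.fdeg w = 1%N.

(** The classes of the entries of [B] form a basis of the degree-one component
    of A(alpha, beta, gamma). *)
Definition basis_of_A1 alpha beta gamma n (B : n.-tuple (freealg k)) : Prop :=
  (forall j, degree_one (tnth B j)) /\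
  (forall v, degree_one v ->
     exists! c : {ffun 'I_n -> k},
       eqA alpha beta gamma v (\sum_j c j *: tnth B j)).

Definition is_Sklyanin alpha beta gamma : Prop :=
  alpha + beta + gamma + alpha * beta * gamma = 0.

End Algebra.

(** * Closed subschemes of projective space through their points

    For a local k-algebra T, the T-points of P^n are the vectors of T^(n+1)
    with an invertible coordinate, up to multiplication by a unit.  Two closed
    subschemes of a k-scheme of finite type coincide as soon as they have the
    same T-points for every local k-algebra T (test on their local rings), so
    equality of schemes is expressed below by comparing such points. *)

Section Points.
Variable T : comUnitRingType.

Definition is_local : Prop :=
  forall t : T, t \is a GRing.unit \/ 1 - t \is a GRing.unit.

Definition is_point (x : 'I_4 -> T) : Prop := exists j, x j \is a GRing.unit.

Definition same_point (x y : 'I_4 -> T) : Prop :=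
  exists2 u : T, u \is a GRing.unit & forall j, y j = u * x j.

Definition e_ (j : 'I_4) : 'I_4 -> T := fun l => (l == j)%:R.

Definition pair_vec (x y : 'I_4 -> T) : 'I_(4 + 4) -> T :=
  fun j => match split j with inl l => x l | inr l => y l end.

End Points.

(** A closed subscheme of P^3 is given by generators of a homogeneous ideal. *)
Notation equations k := (seq (mpoly 4 k)).

(** A morphism to P^3, in [n] homogeneous variables, is given by a finite list
    of quadruples of polynomials, each describing it where they do not all
    vanish. *)
Notation local_formulas k n := (seq (4.-tuple (mpoly n k))).

Section Varieties.
Variable k : fieldType.

Definition on_curve (T : comUnitRingType) (f : {rmorphism k -> T})
    (E : equations k) (x : 'I_4 -> T) : Prop :=
  is_point x /\ forall q, q \in E -> mmap f x q = 0.

Definition value n (T : comUnitRingType) (f : {rmorphism k -> T})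
    (F : local_formulas k n) (v : 'I_n -> T) (y : 'I_4 -> T) : Prop :=
  exists2 G, G \in F &
    let Gv := fun j => mmap f v (tnth G j) in is_point Gv /\ same_point Gv y.

(** [F] defines a map from [X] to [Y]: the formulas cover [X], agree wherever
    several of them apply, and take values in [Y]. *)
Definition maps_to n (L : comUnitRingType) (f : {rmorphism k -> L})
    (F : local_formulas k n) (X : ('I_n -> L) -> Prop) (Y : ('I_4 -> L) -> Prop)
    : Prop :=
  forall v, X v ->
    (exists y, value f F v y) /\
    (forall y, value f F v y ->
       Y y /\ forall y', value f F v y' -> same_point y y').

Definition homogeneous (F : local_formulas k 4) : Prop :=
  forall G, G \in F -> exists d, forall j, tnth G j \is d.-homog.

Definition bihomogeneous (F : local_formulas k (4 + 4)) : Prop :=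
  forall G, G \in F -> exists d d' : nat, forall j mon, mon \in msupp (tnth G j) ->
    (\sum_(l < 4) mon (lshift 4 l))%N = d /\
    (\sum_(l < 4) mon (rshift 4 l))%N = d'.

(** ** Quartic elliptic curves in P^3 *)

Definition in_eq_ideal (E : equations k) (g : mpoly 4 k) : Prop :=
  exists a : 'I_(size E) -> mpoly 4 k, g = \sum_j a j * E`_j.

(** The Hilbert polynomial of [E] is 4t, that is, deg * t + 1 - genus for
    degree 4 and genus 1. *)
Definition hilbert_polynomial_4t (E : equations k) : Prop :=
  exists N, forall n, (N <= n)%N ->
    exists b : 'I_(4 * n) -> mpoly 4 k,
      (forall j, b j \is n.-homog) /\
      forall g, g \is n.-homog ->
        exists! c : {ffun 'I_(4 * n) -> k},
          in_eq_ideal E (g - \sum_j c j *: b j).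

Definition geometrically_irreducible (E : equations k) : Prop :=
  forall (L : closedFieldType) (f : {rmorphism k -> L}) (g h : mpoly 4 L) d d',
    g \is d.-homog -> h \is d'.-homog ->
    (forall x, on_curve f E x -> (g * h).@[x] = 0) ->
    (forall x, on_curve f E x -> g.@[x] = 0) \/
    (forall x, on_curve f E x -> h.@[x] = 0).

(** Jacobian criterion for a one-dimensional subscheme of P^3. *)
Definition smooth_curve (E : equations k) : Prop :=
  forall (L : closedFieldType) (f : {rmorphism k -> L}) x,
    on_curve f E x ->
    \rank (\matrix_(a < size E, j < 4) mmap f x (E`_a)^`M(j)) = 2.

(** A curve with a rational point and formulas for its group law. *)
Record curve_data := CurveData {
  eqns : equations k;
  origin : 'I_4 -> k;
  group_add : local_formulas k (4 + 4);
  group_opp : local_formulas k 4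
}.

Definition quartic_elliptic_curve (C : curve_data) : Prop :=
  [/\ forall q, q \in eqns C -> exists d, q \is d.-homog,
      hilbert_polynomial_4t (eqns C),
      geometrically_irreducible (eqns C),
      smooth_curve (eqns C)
    & on_curve idfun (eqns C) (origin C)].

(** [group_add C] and [group_opp C] make [eqns C] a group variety with neutral element
    [origin C].  On an elliptic curve there is exactly one such structure. *)
Definition group_variety (C : curve_data) : Prop :=
  [/\ bihomogeneous (group_add C), homogeneous (group_opp C) &
  forall (L : closedFieldType) (f : {rmorphism k -> L}),
  let E := on_curve f (eqns C) in
  let o := fun j => f (origin C j) in
  let sum x y := value f (group_add C) (pair_vec x y) in
  [/\ maps_to f (group_add C) (fun v => exists x y, [/\ E x, E y & v = pair_vec x y]) E,
      maps_to f (group_opp C) E E,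
      forall x y z xy yz xyz, E x -> E y -> E z ->
        sum x y xy -> sum y z yz -> sum xy z xyz -> sum x yz xyz,
      forall x, E x -> sum o x x /\ sum x o x
    & forall x x', E x -> value f (group_opp C) x x' -> sum x x' o /\ sum x' x o]].

Definition translation_by (C : curve_data) (p : 'I_4 -> k)
    (tau : local_formulas k 4) : Prop :=
  [/\ on_curve idfun (eqns C) p, homogeneous tau &
  forall (L : closedFieldType) (f : {rmorphism k -> L}),
    let E := on_curve f (eqns C) in
    maps_to f tau E E /\
    forall x y, E x ->
      (value f tau x y <->
       value f (group_add C) (pair_vec x (fun j => f (p j))) y)].

Definition has_order_4 (C : curve_data) (p : 'I_4 -> k) : Prop :=
  exists p2 : 'I_4 -> k,
    [/\ value idfun (group_add C) (pair_vec p p) p2,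
        ~ same_point p2 (origin C)
      & value idfun (group_add C) (pair_vec p2 p2) (origin C)].

(** ** The algebras A(E, tau) *)

(** The value at (x, y) of an element of V (x) V, viewed as a (1,1)-form. *)
Definition biform (T : comUnitRingType) (f : {rmorphism k -> T})
    (r : freealg k) (x y : 'I_4 -> T) : T :=
  \sum_(a < 4) \sum_(b < 4) f (monalg.mcoeff (word [:: a; b]) r) * x a * y b.

Definition in_Gamma alpha beta gamma (T : comUnitRingType)
    (f : {rmorphism k -> T}) (x y : 'I_4 -> T) : Prop :=
  [/\ is_point x, is_point y &
      forall r, r \in relations alpha beta gamma -> biform f r x y = 0].

(** The graph of the automorphism of E u {e_0, ..., e_3} that fixes the e_j and
    is tau on E; a point over a local ring lies in one of the components. *)
Definition in_graph (C : curve_data) (tau : local_formulas k 4)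
    (T : comUnitRingType) (f : {rmorphism k -> T}) (x y : 'I_4 -> T) : Prop :=
  (exists j, same_point (e_ T j) x /\ same_point (e_ T j) y) \/
  (on_curve f (eqns C) x /\ value f tau x y).

Definition is_A_E_tau alpha beta gamma (C : curve_data)
    (tau : local_formulas k 4) : Prop :=
  [/\ quartic_elliptic_curve C, group_variety C,
      exists p, translation_by C p tau &
  forall (T : comUnitRingType) (f : {rmorphism k -> T}), is_local T ->
    forall x y, in_Gamma alpha beta gamma f x y <-> in_graph C tau f x y].

End Varieties.

(* Main.v *)
Require Import Defs.
From HB Require Import structures.
From mathcomp Require Import all_boot all_order all_algebra.
From mathcomp.multinomials Require Import monalg mpoly.
From mathcomp Require Import ring zify.
Import GRing.Theory.
Set Implicit Arguments.
Unset Strict Implicit.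
Unset Printing Implicit Defensive.
Local Open Scope ring_scope.

(** When beta = 1 and gamma = -1, the sums and differences of the two relations that
    start with x0 x2, and of the two that start with x0 x3, are monomial equations
      x0 y2 = x3 y1,  x1 y2 = x3 y0,  x0 y3 = - x2 y1,  x1 y3 = - x2 y0.
    They make (y2, y3) proportional to (x3, -x2), with the same factor as for
    (y0, y1) and (x1, x0).  So, away from the points e_j, Gamma is the graph of the
    linear map tau (x0, x1, x2, x3) = (x1, x0, x3, -x2), and the two relations which
    are left say that x lies on the intersection E of the quadrics
      2 x0^2 + (1 + alpha) x2^2 + (1 - alpha) x3^2 = 0,
      2 x1^2 + (1 - alpha) x2^2 + (1 + alpha) x3^2 = 0.
    Over a local ring one only has to follow which coordinates are units
    ([Gamma_split], [Gamma_graph]).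

    The group law comes from the coordinates X = x0 - x1, Y = x0 + x1,
    Z = - i (x2 + x3), T = - i alpha (x2 - x3), in which E has the equations
      X Y = Z T,   X^2 + Y^2 = Z^2 + alpha^-2 T^2.
    This is the Edwards curve, embedded in P^3 through P^1 x P^1.  It carries two
    bihomogeneous addition laws, which agree where both are defined and cover all
    pairs of points ([add_law_cover]).  In the coordinates of P^1 x P^1 every group
    axiom is a polynomial identity modulo the equation of the curve; associativity
    holds for each of the sixteen ways to choose the laws in the four additions
    ([bip_addA]), so that no genericity argument is needed.  With (1, 1, i, i) as
    neutral element, tau is the addition of p = (1, 1, i, -i) ([translation_law]).
    As tau^2 changes the signs of x2 and x3, the point p has order 4.

    The coordinate ring of E is free over k[x2, x3] on 1, x0, x1, x0 x1.  Counting
    monomials gives the Hilbert polynomial 4t ([hilbert_curve]).  The same normal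
    form gives irreducibility: the function field is the extension of L(t) by the
    square roots of two quadratic polynomials A and B, and none of A, B, A B is a
    square since each has a root of odd multiplicity; so the norm of a nonzero
    element is a nonzero polynomial in t ([biquadratic_norm_eq0]).  Smoothness holds
    because no point of E has two vanishing coordinates ([two_zeros]).

    For the last part, the monomial equations read x0 x2 = x3 x1 and so on in the
    algebra.  They say that multiplication by x0 + c x1 with c = 1, -1 exchanges sides
    with x2 + d x3, where d^2 = -1, up to the scalar - c d ([KY_commute]). *)

(** * The index type of the four coordinates *)

Local Notation i0 := (inord 0 : 'I_4).
Local Notation i1 := (inord 1 : 'I_4).
Local Notation i2 := (inord 2 : 'I_4).
Local Notation i3 := (inord 3 : 'I_4).

Lemma ord4_ind (P : 'I_4 -> Prop) :
  P i0 -> P i1 -> P i2 -> P i3 -> forall j, P j.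
Proof.
move=> P0 P1 P2 P3 [[|[|[|[|]]]] lt_j4] //;
  by [have -> // : Ordinal lt_j4 = i0 by apply: val_inj; rewrite /= inordK
     |have -> // : Ordinal lt_j4 = i1 by apply: val_inj; rewrite /= inordK
     |have -> // : Ordinal lt_j4 = i2 by apply: val_inj; rewrite /= inordK
     |have -> // : Ordinal lt_j4 = i3 by apply: val_inj; rewrite /= inordK].
Qed.

Lemma tnth_ord4 T (a b c d : T) :
  (tnth [tuple a; b; c; d] i0 = a) * (tnth [tuple a; b; c; d] i1 = b) *
  (tnth [tuple a; b; c; d] i2 = c) * (tnth [tuple a; b; c; d] i3 = d).
Proof. by rewrite !(tnth_nth a) !inordK. Qed.

Lemma big_ord4 R (idx : R) (op : Monoid.law idx) (F : 'I_4 -> R) :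
  \big[op/idx]_(j < 4) F j = op (F i0) (op (F i1) (op (F i2) (F i3))).
Proof.
rewrite !big_ord_recl big_ord0 Monoid.mulm1.
by congr (op (F _) (op (F _) (op (F _) (F _))));
  apply: val_inj; rewrite /= inordK.
Qed.

(** A rewrite rule for all pairs at once, so that Kronecker symbols evaluate. *)
Lemma neq_ord4 : (i0 == i1 = false) * (i0 == i2 = false) * (i0 == i3 = false) *
 (i1 == i0 = false) * (i1 == i2 = false) * (i1 == i3 = false) *
 (i2 == i0 = false) * (i2 == i1 = false) * (i2 == i3 = false) *
 (i3 == i0 = false) * (i3 == i1 = false) * (i3 == i2 = false).
Proof. by rewrite -!val_eqE /= !inordK. Qed.

(** * The two quadrics and the Edwards addition laws *)

Section Coordinates.
Variable T : comUnitRingType.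
Implicit Types (al im : T) (x y : 'I_4 -> T).

Definition quadric0 al x := 2%:R * x i0 ^+ 2 + (1 + al) * x i2 ^+ 2 + (1 - al) * x i3 ^+ 2.
Definition quadric1 al x := 2%:R * x i1 ^+ 2 + (1 - al) * x i2 ^+ 2 + (1 + al) * x i3 ^+ 2.

Definition on_quadrics al x := quadric0 al x = 0 /\ quadric1 al x = 0.

(** The point ((x : z), (y : t)) of P^1 x P^1; the Segre coordinates of the Edwards
    curve are X = x t, Y = z y, Z = z t, T = x y. *)
Record bipoint := Bipoint { sx : T; sz : T; sy : T; st : T }.

(** The point of P^3 whose coordinates X, Y, Z, T are 2 alpha times the Segre
    coordinates; the factor clears denominators. *)
Definition segre al im s : 4.-tuple T :=
  let: Bipoint x z y t := s in
  [tuple al * (z * y + x * t); al * (z * y - x * t);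
         im * (al * (z * t) + x * y); im * (al * (z * t) - x * y)].

(** The two addition laws, up to common factors.  In the affine coordinates X / Z and
    Y / Z, which are called x and y here, [true] is the Edwards law
    x3 = (x1 y2 + y1 x2) / (1 + d x1 x2 y1 y2), y3 = (y1 y2 - x1 x2) / (1 - d x1 x2 y1 y2)
    with d = alpha^-2, and [false] is the dual law, which does not involve d:
    x3 = (x1 y1 + x2 y2) / (y1 y2 + x1 x2), y3 = (x1 y1 - x2 y2) / (x1 y2 - y1 x2).
    Numerators and denominators are bilinear in the coordinates of P^3. *)
Definition add_law (b : bool) al x y : bipoint :=
  if b then
    Bipoint (x i0 * y i0 - x i1 * y i1) (- (x i2 * y i2 + x i3 * y i3))
        (x i0 * y i1 + x i1 * y i0) (- (x i2 * y i3 + x i3 * y i2))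
  else
    Bipoint (- (al * (x i2 * y i2 - x i3 * y i3))) (x i0 * y i0 + x i1 * y i1)
        (- (al * (x i2 * y i3 - x i3 * y i2))) (x i0 * y i1 - x i1 * y i0).

End Coordinates.

Section EdwardsLaws.
Variable T : comUnitRingType.
Implicit Types (al im : T) (p q r : bipoint T).

(** The equation X^2 + Y^2 = Z^2 + alpha^-2 T^2, solved for its monomial x^2 y^2: as a
    rewrite rule it then decides membership in the ideal of the curve, also for
    several points in independent variables. *)
Definition on_edwards al p := let: Bipoint x z y t := p in
  x^+2 * y^+2 = al^+2 * (x^+2 * t^+2 + z^+2 * y^+2 - z^+2 * t^+2).

Definition bip_add (b : bool) al p q :=
  let: Bipoint x1 z1 y1 t1 := p in let: Bipoint x2 z2 y2 t2 := q in
  if b then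
    Bipoint (al^+2*(x1*t1*z2*y2+z1*y1*x2*t2)) (al^+2*(z1*t1*z2*t2)+x1*y1*x2*y2)
        (al^+2*(z1*y1*z2*y2-x1*t1*x2*t2)) (al^+2*(z1*t1*z2*t2)-x1*y1*x2*y2)
  else
    Bipoint (x1*y1*z2*t2+z1*t1*x2*y2) (z1*y1*z2*y2+x1*t1*x2*t2)
        (x1*y1*z2*t2-z1*t1*x2*y2) (x1*t1*z2*y2-z1*y1*x2*t2).

Definition bip_eq p q := sx p * sz q = sx q * sz p /\ sy p * st q = sy q * st p.

Definition bip0 : bipoint T := Bipoint 0 1 1 1.
Definition bip_opp p := let: Bipoint x z y t := p in Bipoint (- x) z y t.
(** [bip_tau] is tau in the coordinates of P^1 x P^1. *)
Definition bip_tau al p := let: Bipoint x z y t := p in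
  Bipoint (al * t) y (al * z) (- x).

Variable al : T.
Lemma bip_add_agree p q b b' : on_edwards al p -> on_edwards al q ->
  bip_eq (bip_add b al p q) (bip_add b' al p q).
Proof.
case: p q => [x1 z1 y1 t1] [x2 z2 y2 t2]; rewrite /bip_eq /= => h1 h2.
case: b; case: b' => /=; split; ring: h1 h2.
Qed.

Lemma bip_add_on p q b :
  on_edwards al p -> on_edwards al q -> on_edwards al (bip_add b al p q).
Proof.
case: p q => [x1 z1 y1 t1] [x2 z2 y2 t2]; case: b => /= h1 h2; ring: h1 h2.
Qed.

(** For each of the sixteen choices of laws both sides agree as elements of the
    coordinate ring of the triple product of the curve, including at the points
    where some law degenerates to a zero vector. *)
Lemma bip_addA p q r b1 b2 b3 b4 :
  on_edwards al p -> on_edwards al q -> on_edwards al r ->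
  bip_eq (bip_add b3 al (bip_add b1 al p q) r)
         (bip_add b4 al p (bip_add b2 al q r)).
Proof.
case: p q r => [x1 z1 y1 t1] [x2 z2 y2 t2] [x3 z3 y3 t3].
rewrite /bip_eq /= => h1 h2 h3.
by case: b1; case: b2; case: b3; case: b4; split=> /=; ring: h1 h2 h3.
Qed.

Lemma bip_add0p p b : on_edwards al p -> bip_eq (bip_add b al bip0 p) p.
Proof. by case: p => x z y t h; case: b; split=> /=; ring: h. Qed.
Lemma bip_addp0 p b : on_edwards al p -> bip_eq (bip_add b al p bip0) p.
Proof. by case: p => x z y t h; case: b; split=> /=; ring: h. Qed.
Lemma bip_addpN p b : on_edwards al p -> bip_eq (bip_add b al p (bip_opp p)) bip0.
Proof. by case: p => x z y t h; case: b; split=> /=; ring: h. Qed.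
Lemma bip_addNp p b : on_edwards al p -> bip_eq (bip_add b al (bip_opp p) p) bip0.
Proof. by case: p => x z y t h; case: b; split=> /=; ring: h. Qed.
(** [Bipoint al 1 1 0] is the point (1, 1, i, -i). *)
Lemma bip_add_tau p b : on_edwards al p ->
  bip_eq (bip_add b al p (Bipoint al 1 1 0)) (bip_tau al p).
Proof. by case: p => x z y t h; case: b; split=> /=; ring: h. Qed.

Lemma bip0_on : on_edwards al bip0. Proof. by rewrite /=; ring. Qed.
Lemma bip_opp_on p : on_edwards al p -> on_edwards al (bip_opp p).
Proof. by case: p => x z y t /= h; ring: h. Qed.
Lemma bip_tau_on p : on_edwards al p -> on_edwards al (bip_tau al p).
Proof. by case: p => x z y t /= h; ring: h. Qed.
End EdwardsLaws.

(** * Points of projective space *)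

Section SamePoint.
Variable T : comUnitRingType.
Implicit Types x y z : 'I_4 -> T.

Lemma same_point_sym x y : same_point x y -> same_point y x.
Proof.
by case=> u u_unit e; exists u^-1 => [|j]; rewrite ?unitrV // e mulKr.
Qed.

Lemma same_point_trans x y z : same_point x y -> same_point y z -> same_point x z.
Proof.
case=> u uu e [v vu e']; exists (v * u) => [|j]; first by rewrite unitrM vu.
by rewrite e' e mulrA.
Qed.

Lemma eq_same_point x y : x =1 y -> same_point x y.
Proof. by move=> e; exists 1 => [|j]; rewrite ?unitr1 // mul1r e. Qed.

Lemma is_point_same x y : same_point x y -> is_point x -> is_point y.
Proof. by case=> u uu e [j xj]; exists j; rewrite e unitrM uu. Qed.
End SamePoint.

(** * The Segre parametrization of the curve *)

Section OverField.
Variables (L : fieldType) (al im : L).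
Hypotheses (two_neq0 : 2%:R != 0 :> L) (im2 : im ^+ 2 = -1).
Hypotheses (al0 : al != 0) (al1 : 1 - al != 0) (alN1 : 1 + al != 0).
Implicit Types (x y z w : 'I_4 -> L) (p q r s : bipoint L).

Definition bip_valid p :=
  (sx p != 0 \/ sz p != 0) /\ (sy p != 0 \/ st p != 0).

Definition segre_pt p : 'I_4 -> L := tnth (segre al im p).

Lemma im_neq0 : im != 0.
Proof. by apply: contra_eq_neq im2 => ->; rewrite expr0n /= eq_sym oppr_eq0 oner_eq0. Qed.

(** Sums and differences of coordinates recover X, Y, Z, T. *)
Lemma segre_pt_spec p : let: Bipoint x z y t := p in
  [/\ segre_pt p i0 + segre_pt p i1 = 2%:R * al * (z * y),
      segre_pt p i0 - segre_pt p i1 = 2%:R * al * (x * t),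
      segre_pt p i2 + segre_pt p i3 = 2%:R * im * al * (z * t)
    & segre_pt p i2 - segre_pt p i3 = 2%:R * im * (x * y)].
Proof. by case: p => x z y t; rewrite /segre_pt /= !tnth_ord4; split; ring. Qed.

Lemma segre_pt_is_point p : is_point (segre_pt p) <-> bip_valid p.
Proof.
have e := segre_pt_spec p; case: p e => x z y t; set v := segre_pt _ => -[e1 e2 e3 e4].
split=> [[j vj]|].
{ have dich (a b : L) : (a = 0 /\ b = 0) \/ (a != 0 \/ b != 0).
    have [->|] := eqVneq a 0; last by right; left.
    by have [->|] := eqVneq b 0; [left|right; right].
  have [[? ?]|hx] := dich x z; last have [[? ?]|hy //] := dich y t; subst.
    all: exfalso; move: vj; rewrite unitfE /v /segre_pt; elim/ord4_ind: j;
      by rewrite /= !tnth_ord4 !(mul0r, mulr0, subr0, addr0, eqxx). }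
have nz : forall a b c : L, a + b = c -> c != 0 -> a != 0 \/ b != 0.
    move=> a b c <-; have [->|] := eqVneq a 0; last by left.
    by rewrite add0r; right.
  have nz' : forall a b c : L, a - b = c -> c != 0 -> a != 0 \/ b != 0.
    by move=> a b c /nz h /h []; [left|right; rewrite -oppr_eq0].
  have k1 : 2%:R * im != 0 by rewrite mulf_neq0 ?im_neq0.
  rewrite /bip_valid /= => -[hx hy].
  have : (v i0 != 0 \/ v i1 != 0) \/ (v i2 != 0 \/ v i3 != 0).
    case: hx => hx; case: hy => hy.
    - by right; apply: nz' e4 _; rewrite !mulf_neq0 ?im_neq0.
    - by left; apply: nz' e2 _; rewrite !mulf_neq0 ?im_neq0.
    - by left; apply: nz e1 _; rewrite !mulf_neq0 ?im_neq0.
    - by right; apply: nz e3 _; rewrite !mulf_neq0 ?im_neq0.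
  by case=> [] []; [exists i0|exists i1|exists i2|exists i3]; rewrite unitfE.
Qed.

(** The first quadric minus the second is X Y = Z T, so a point of the curve comes
    from P^1 x P^1; their sum is then the Edwards equation. *)
Lemma segre_ptP x : on_quadrics al x -> is_point x ->
  exists p, [/\ bip_valid p, on_edwards al p & segre_pt p =1 x].
Proof.
case=> h1 h2 [j xj].
pose X := (x i0 - x i1) / (2%:R * al); pose Y := (x i0 + x i1) / (2%:R * al).
pose Z := - im * (x i2 + x i3) / (2%:R * al); pose T := - im * (x i2 - x i3) / 2%:R.
have x0E : x i0 = al * (Y + X) by rewrite /X /Y; field; rewrite al0 two_neq0.
have x1E : x i1 = al * (Y - X) by rewrite /X /Y; field; rewrite al0 two_neq0.
have x2E : x i2 = im * (al * Z + T).
  by rewrite /Z /T; field: im2; rewrite al0 two_neq0.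
have x3E : x i3 = im * (al * Z - T).
  by rewrite /Z /T; field: im2; rewrite al0 two_neq0.
have XY : X * Y = Z * T.
  apply: (mulfI (mulf_neq0 (mulf_neq0 two_neq0 two_neq0)
      (mulf_neq0 two_neq0 (mulf_neq0 al0 al0)))).
  have e : quadric0 al x - quadric1 al x = 0 by rewrite h1 h2 subrr.
  apply: subr0_eq; rewrite -[RHS]e.
  by rewrite /quadric0 /quadric1 x0E x1E x2E x3E; ring: im2.
have XYZT : al ^+ 2 * (X ^+ 2 + Y ^+ 2) = al ^+ 2 * Z ^+ 2 + T ^+ 2.
  apply: (mulfI (mulf_neq0 two_neq0 two_neq0)).
  have e : quadric0 al x + quadric1 al x = 0 by rewrite h1 h2 addr0.
  apply: subr0_eq; rewrite -[RHS]e.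
  by rewrite /quadric0 /quadric1 x0E x1E x2E x3E; ring: im2.
clearbody X Y Z T.
(* One of three points of P^1 x P^1 works: the ruling (x : z) is (X : Z) unless X
   and Z both vanish, and is (T : Y) in that case. *)
have [Z0|Z0] := eqVneq Z 0; last first.
  have ZY : Z * (Y / Z) = Y by field.
  have XT : X * (Y / Z) = T by rewrite mulrA XY mulrAC mulfV // mul1r.
  have ptE : segre_pt (Bipoint X Z (Y / Z) 1) =1 x.
    by apply: ord4_ind; rewrite /segre_pt /= !tnth_ord4 ?ZY ?XT !mulr1.
  exists (Bipoint X Z (Y / Z) 1); split=> //.
  - by split=> /=; right; rewrite ?oner_eq0.
  - rewrite /=; apply: (mulfI (expf_neq0 2 Z0)).
    have -> : Z ^+ 2 * (X ^+ 2 * (Y / Z) ^+ 2) = (X * Y) ^+ 2.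
      by field.
    have -> : Z ^+ 2 * (al ^+ 2 * (X ^+ 2 * 1 ^+ 2 + Z ^+ 2 * (Y / Z) ^+ 2 - Z ^+ 2 * 1 ^+ 2))
      = Z ^+ 2 * (al ^+ 2 * (X ^+ 2 + Y ^+ 2) - al ^+ 2 * Z ^+ 2) by field.
    by rewrite XYZT XY; ring.
have [X0|X0] := eqVneq X 0; last first.
  have Y0 : Y = 0.
    by apply: (mulfI X0); rewrite XY Z0 mul0r mulr0.
  exists (Bipoint X 0 (T / X) 1); split=> //.
  - by split=> /=; [left|right; rewrite oner_eq0].
  - rewrite /=; have -> : X ^+ 2 * (T / X) ^+ 2 = T ^+ 2 by field.
    have -> : T ^+ 2 = al ^+ 2 * (X ^+ 2 + Y ^+ 2) by rewrite XYZT Z0; ring.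
    by rewrite Y0; ring.
  - apply: ord4_ind; rewrite /segre_pt /= !tnth_ord4 ?x0E ?x1E ?x2E ?x3E ?Z0 ?Y0;
      rewrite ?[X * _]mulrC ?divfK //; ring.
subst X Z.
exists (Bipoint T Y 1 0); split.
- split=> /=; last by left; rewrite oner_eq0.
  have [T0|] := eqVneq T 0; last by left.
  right; apply: contraTneq xj => Y0; rewrite unitfE negbK; elim/ord4_ind: j;
   by rewrite ?x0E ?x1E ?x2E ?x3E ?T0 ?Y0; apply/eqP; ring.
- by move: XYZT => /=; rewrite !(expr0n, expr1n, mulr0, addr0, subr0, mulr1, add0r,
    mul0r) /= => ->.
- by apply: ord4_ind; rewrite /segre_pt /= !tnth_ord4 ?x0E ?x1E ?x2E ?x3E; ring.
Qed.

Lemma segre_pt_on p : on_edwards al p -> on_quadrics al (segre_pt p).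
Proof.
case: p => x z y t /= h; rewrite /on_quadrics /quadric0 /quadric1 /segre_pt /= !tnth_ord4.
by split; ring: h im2.
Qed.

Lemma proportionalP (a b c d : L) : (a != 0 \/ b != 0) -> (c != 0 \/ d != 0) ->
  a * d = c * b -> exists2 u, u != 0 & c = u * a /\ d = u * b.
Proof.
move=> ab cd e; have [a0|a0] := eqVneq a 0.
  have b0 : b != 0 by case: ab => //; rewrite a0 eqxx.
  have c0 : c = 0.
    by apply/eqP; move/eqP: e; rewrite a0 mul0r eq_sym mulf_eq0 (negPf b0) orbF.
  exists (d / b); first by rewrite mulf_neq0 ?invr_neq0 //; case: cd => //; rewrite c0 eqxx.
  by rewrite c0 a0 mulr0 divfK.
exists (c / a); last by rewrite divfK // mulrAC -e mulrAC mulfV // mul1r.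
rewrite mulf_neq0 ?invr_neq0 //; apply/eqP => c0; move/eqP: e.
rewrite c0 mul0r mulf_eq0 (negPf a0) /= => /eqP d0.
by case: cd; rewrite ?c0 ?d0 eqxx.
Qed.

Lemma segre_of_bip_eq p q : bip_valid p -> bip_valid q -> bip_eq p q ->
    same_point (segre_pt p) (segre_pt q).
Proof.
case: p q => x z y t [x' z' y' t'] [/= v1 v2] [/= v1' v2'] [/= e1 e2].
have [u u0 [-> ->]] := proportionalP v1 v1' e1.
have [v w0 [-> ->]] := proportionalP v2 v2' e2.
exists (u * v); first by rewrite unitfE mulf_neq0.
by apply: ord4_ind; rewrite /segre_pt /= !tnth_ord4; ring.
Qed.

Lemma bip_eq_sym p q : bip_eq p q -> bip_eq q p.
Proof. by case. Qed.

End OverField.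

(** * The two addition laws cover all pairs of points *)

Section Covering.
Variables (L : fieldType) (al : L).
Hypotheses (two_neq0 : 2%:R != 0 :> L).
Hypotheses (al0 : al != 0) (al1 : 1 - al != 0) (alN1 : 1 + al != 0).
Implicit Types (x y z w : 'I_4 -> L) (p q r s : bipoint L).

Lemma sq_eq0 (c a : L) : c != 0 -> c * a ^+ 2 = 0 -> a = 0.
Proof. by move=> c0 /eqP; rewrite mulf_eq0 (negPf c0) expf_eq0 /= => /eqP. Qed.

(** Eliminating a variable from the two quadrics leaves coefficients 1 + alpha,
    1 - alpha, 2 and 4 alpha, all nonzero; so once two squares vanish all four do. *)
Lemma two_zeros x (j l : 'I_4) : on_quadrics al x -> j != l ->
  x j = 0 -> x l = 0 -> forall m, x m = 0.
Proof.
case; set f1 := quadric0 al x; set f2 := quadric1 al x => h1 h2.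
have al4 : 2%:R * 2%:R * al != 0 by rewrite !mulf_neq0.
have e23 : 2%:R * 2%:R * al * x i2 ^+ 2 =
    - (2%:R * (1 + al) * x i0 ^+ 2 - 2%:R * (1 - al) * x i1 ^+ 2).
  apply: subr0_eq; transitivity ((1 + al) * f1 - (1 - al) * f2).
    by rewrite /f1 /f2 /quadric0 /quadric1; ring.
  by rewrite h1 h2; ring.
have e32 : 2%:R * 2%:R * al * x i3 ^+ 2 =
    2%:R * (1 - al) * x i0 ^+ 2 - 2%:R * (1 + al) * x i1 ^+ 2.
  apply: subr0_eq; transitivity (- (1 - al) * f1 + (1 + al) * f2).
    by rewrite /f1 /f2 /quadric0 /quadric1; ring.
  by rewrite h1 h2; ring.
have fin : x i2 = 0 -> x i3 = 0 -> forall m, x m = 0.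
  move=> x2 x3; apply: ord4_ind => //; apply: (sq_eq0 two_neq0).
    by rewrite -h1 /f1 /quadric0 x2 x3; ring.
  by rewrite -h2 /f2 /quadric1 x2 x3; ring.
have s2 : x i0 = 0 -> x i2 = 0 -> forall m, x m = 0.
  move=> x0 x2; apply: fin => //; apply: (sq_eq0 al1).
  by rewrite -h1 /f1 /quadric0 x0 x2; ring.
have s3 : x i0 = 0 -> x i3 = 0 -> forall m, x m = 0.
  move=> x0 x2; apply: fin => //; apply: (sq_eq0 alN1).
  by rewrite -h1 /f1 /quadric0 x0 x2; ring.
have t2 : x i1 = 0 -> x i2 = 0 -> forall m, x m = 0.
  move=> x0 x2; apply: fin => //; apply: (sq_eq0 alN1).
  by rewrite -h2 /f2 /quadric1 x0 x2; ring.
have t3 : x i1 = 0 -> x i3 = 0 -> forall m, x m = 0.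
  move=> x0 x2; apply: fin => //; apply: (sq_eq0 al1).
  by rewrite -h2 /f2 /quadric1 x0 x2; ring.
have r01 : x i0 = 0 -> x i1 = 0 -> forall m, x m = 0.
  move=> x0 x1; apply: fin; apply: (sq_eq0 al4); rewrite ?e23 ?e32 x0 x1; ring.
by elim/ord4_ind: j; elim/ord4_ind: l; rewrite ?neq_ord4 ?eqxx // => _; auto.
Qed.

Lemma not_point0 x : is_point x -> (forall m, x m = 0) -> False.
Proof. by case=> j + h; rewrite h unitr0. Qed.

Lemma pair_neq0P (a b : L) : (a = 0 /\ b = 0) \/ (a != 0 \/ b != 0).
Proof.
have [->|] := eqVneq a 0; last by right; left.
by have [->|] := eqVneq b 0; [left|right; right].
Qed.

Lemma bip_validVn p :
  bip_valid p \/ (sx p = 0 /\ sz p = 0) \/ (sy p = 0 /\ st p = 0).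
Proof.
case: p => x z y t; rewrite /bip_valid /=.
have [] := pair_neq0P x z; have [] := pair_neq0P y t; tauto.
Qed.

(** The pairs (x_j, x_l) and (y_j, y_l) are nonzero on the curve by [two_zeros]. *)
Lemma proportional_pair x y j l (sg : L) : sg ^+ 2 = 1 -> on_quadrics al x ->
    on_quadrics al y ->
  is_point x -> is_point y -> j != l ->
  x j * y l = sg * (x l * y j) -> exists2 u, u != 0 & y j = u * x j /\ y l = sg * u * x l.
Proof.
move=> sg2 Ex Ey px py jl e.
have nz z : on_quadrics al z -> is_point z -> z j != 0 \/ z l != 0.
  move=> Ez pz; have [zj|] := eqVneq (z j) 0; last by left.
  have [zl|] := eqVneq (z l) 0; last by right.
  by case: (not_point0 pz (two_zeros Ez jl zj zl)).
have sg0 : sg != 0 by apply: contra_eq_neq sg2 => ->; rewrite expr0n eq_sym oner_eq0.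
have nzy : y j != 0 \/ sg * y l != 0.
  by case: (nz y Ey py) => h; [left|right; rewrite mulf_neq0].
have [|u u0 [e1 e2]] := proportionalP (nz x Ex px) nzy.
  by ring: e sg2.
exists u => //; split=> //.
by rewrite -mulrA -e2; ring: sg2.
Qed.

(** If both laws vanish at (x, y), each does so through one of its two factors in
    P^1 x P^1.  For equal factors four products x_j y_l vanish in which every index
    occurs once on each side, so x or y has two zero coordinates.  For different
    factors (x0, x1) and (y0, y1) are proportional up to a sign, and likewise the
    other coordinates, which forces x0^2 = x1^2 and x2^2 = - x3^2; this is
    impossible on the curve. *)
Lemma add_law_cover x y : on_quadrics al x -> on_quadrics al y ->
  is_point x -> is_point y ->
  exists b, bip_valid (add_law b al x y).
Proof.
move=> Ex Ey px py.
have [|n1] := bip_validVn (add_law true al x y); first by exists true.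
have [|n2] := bip_validVn (add_law false al x y); first by exists false.
exfalso; move: n1 n2; rewrite /=.
have atmost1 z : on_quadrics al z -> is_point z -> forall j l, z j = 0 -> z l = 0 -> j = l.
  move=> Ez pz j l zj zl; apply/eqP/negP => /negP jl.
  exact: (not_point0 pz (two_zeros Ez jl zj zl)).
have mul2 (a : L) : 2%:R * a = 0 -> a = 0.
  by move/eqP; rewrite mulf_eq0 (negPf two_neq0) => /eqP.
have alK (a : L) : - (al * a) = 0 -> a = 0.
  by move/eqP; rewrite oppr_eq0 mulf_eq0 (negPf al0) => /eqP.
have split0 (a b : L) : a - b = 0 -> a + b = 0 -> a = 0 /\ b = 0.
  move=> e1 e2; split; apply: mul2.
    by transitivity ((a - b) + (a + b)); [ring | rewrite e1 e2 addr0].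
  by transitivity ((a + b) - (a - b)); [ring | rewrite e1 e2 subr0].
have zz (a b : L) : a * b = 0 -> a = 0 \/ b = 0.
  by move/eqP; rewrite mulf_eq0 => /orP[] /eqP; [left|right].
have four (j0 j1 j2 j3 : 'I_4) : uniq [:: i0; i1; i2; i3] -> uniq [:: j0; j1; j2; j3] ->
    x i0 * y j0 = 0 -> x i1 * y j1 = 0 -> x i2 * y j2 = 0 -> x i3 * y j3 = 0 -> False.
  rewrite /= !inE !negb_or !neq_ord4 /= => _ /and4P[/and3P[n01 n02 n03] /andP[n12 n13] n23 _].
  have Ax := atmost1 _ Ex px; have Ay := atmost1 _ Ey py.
  have Ax' j l : j == l = false -> x j = 0 -> x l = 0 -> False.
    by move=> /eqP n h1 h2; apply: n; apply: Ax.
  have Ay' j l : j != l -> y j = 0 -> y l = 0 -> False.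
    by move=> /eqP n h1 h2; apply: n; apply: Ay.
  have N := neq_ord4.
  case/zz => ?; case/zz => ?; case/zz => ?; case/zz => ?;
    solve [by apply: (@Ax' i0 i1); rewrite ?N | by apply: (@Ax' i0 i2);
        rewrite ?N | by apply: (@Ax' i0 i3); rewrite ?N | by apply: (@Ax' i1 i2); rewrite ?N
    | by apply: (@Ax' i1 i3); rewrite ?N | by apply: (@Ax' i2 i3); rewrite ?N
    | exact: (Ay' _ _ n01)| exact: (Ay' _ _ n02)| exact: (Ay' _ _ n03)
    | exact: (Ay' _ _ n12)| exact: (Ay' _ _ n13)| exact: (Ay' _ _ n23)].
have u4 : uniq [:: i0; i1; i2; i3] by rewrite /= !inE !neq_ord4.
have u4' : uniq [:: i1; i0; i3; i2] by rewrite /= !inE !neq_ord4.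
have bad : x i0 ^+ 2 = x i1 ^+ 2 -> x i2 ^+ 2 = - x i3 ^+ 2 -> False.
  move=> e1 e2; case: (Ex); rewrite /quadric0 /quadric1 -e1 e2 => h1 h2.
  have x3 : x i3 = 0.
    apply: (@sq_eq0 (2%:R * al)); first exact: mulf_neq0.
    apply: mul2.
    transitivity (0 - 0 : L); last by rewrite subrr.
    by rewrite -{1}h2 -h1; ring.
  have x2 : x i2 = 0 by apply/eqP; rewrite -sqrf_eq0 e2 x3 expr0n /= oppr0.
  by have /eqP := atmost1 x Ex px _ _ x2 x3; rewrite neq_ord4.
have sq1 (u v : L) : u != 0 -> u * v = 0 -> v = 0.
  by move=> u0 /eqP; rewrite mulf_eq0 (negPf u0) => /eqP.
case=> -[e1 e2]; case=> -[e3 e4].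
- move/eqP: e2; rewrite oppr_eq0 => /eqP e2; move/alK: e3 => e3.
  have [f0 f1] := split0 _ _ e1 e4; have [f2 f3] := split0 _ _ e3 e2.
  exact: (four i0 i1 i2 i3).
- move/eqP: e2; rewrite oppr_eq0 => /eqP e2; move/alK: e3 => /subr0_eq e3.
  move/subr0_eq: e4 => e4; move/subr0_eq: e1 => e1.
  have [||u u0 [g0 g1]] := @proportional_pair x y i0 i1 1 (expr1n _ _) Ex Ey px py.
  - by rewrite neq_ord4.
  - by rewrite mul1r e4.
  have [||v v0 [g2 g3]] := @proportional_pair x y i2 i3 1 (expr1n _ _) Ex Ey px py.
  - by rewrite neq_ord4.
  - by rewrite mul1r e3.
  apply: bad.
  + by apply: subr0_eq; apply: (sq1 u) => //; rewrite -[RHS](subrr (x i1 * y i1))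
      -{1}e1 g0 g1; ring.
  + apply: subr0_eq; apply: (sq1 v) => //; rewrite -e2 g2 g3; ring.
- move/alK: e3 => /subr0_eq e3; move/eqP: e2; rewrite oppr_eq0 => /eqP e2.
  have sgN : (-1 : L) ^+ 2 = 1 by rewrite sqrrN expr1n.
  have [||u u0 [g0 g1]] := @proportional_pair x y i0 i1 (-1) sgN Ex Ey px py.
  - by rewrite neq_ord4.
  - by rewrite mulN1r; apply/eqP; rewrite -addr_eq0 e1.
  have [||v v0 [g2 g3]] := @proportional_pair x y i2 i3 (-1) sgN Ex Ey px py.
  - by rewrite neq_ord4.
  - by rewrite mulN1r; apply/eqP; rewrite -addr_eq0 e2.
  apply: bad.
  + by apply: subr0_eq; apply: (sq1 u) => //; rewrite -e4 g0 g1; ring.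
  + by apply: subr0_eq; apply: (sq1 v) => //;
      rewrite -[RHS](subrr (x i3 * y i3)) -{1}e3 g2 g3; ring.
- move/eqP: e2; rewrite oppr_eq0 => /eqP e2; move/alK: e3 => e3.
  have [f0 f1] := split0 _ _ e4 e1; have [f2 f3] := split0 _ _ e3 e2.
  exact: (four i1 i0 i3 i2).
Qed.

End Covering.

(** * The formulas as polynomials, and their values *)

Section Formulas.
Variables (k : fieldType) (alpha i : k).

Definition curve_eqns : equations k :=
  [:: quadric0 alpha%:MP (fun j => 'X_j); quadric1 alpha%:MP (fun j => 'X_j)].

Definition add_formula b : 4.-tuple (mpoly (4 + 4) k) :=
  segre alpha%:MP i%:MP
    (add_law b alpha%:MP (fun j => 'X_(lshift 4 j)) (fun j => 'X_(rshift 4 j))).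

(** This map changes the signs of X and T. *)
Definition opp_formula : 4.-tuple (mpoly 4 k) :=
  [tuple 'X_i1; 'X_i0; 'X_i3; 'X_i2].

Definition tau_formula : 4.-tuple (mpoly 4 k) :=
  [tuple 'X_i1; 'X_i0; 'X_i3; - 'X_i2].

Definition neutral : 'I_4 -> k := tnth [tuple 1; 1; i; i].
Definition tau_pt : 'I_4 -> k := tnth [tuple 1; 1; i; - i].

Definition sklyanin_curve : curve_data k :=
  CurveData curve_eqns neutral [:: add_formula true; add_formula false] [:: opp_formula].

Section Eval.
Variables (T : comUnitRingType) (f : {rmorphism k -> T}).
Implicit Types x y w : 'I_4 -> T.

Lemma mmapXi n (v : 'I_n -> T) j : mmap f v 'X_j = v j.
Proof. by rewrite mmapX mmap1U. Qed.

Lemma mmap_quadric0 x : mmap f x (quadric0 alpha%:MP (fun j => 'X_j)) = quadric0 (f alpha) x.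
Proof.
by rewrite /quadric0 !(rmorphXn, rmorph_nat, rmorph1, rmorphN, rmorphD,
    rmorphM) /= !mmapXi !mmapC.
Qed.
Lemma mmap_quadric1 x : mmap f x (quadric1 alpha%:MP (fun j => 'X_j)) = quadric1 (f alpha) x.
Proof.
by rewrite /quadric1 !(rmorphXn, rmorph_nat, rmorph1, rmorphN, rmorphD,
    rmorphM) /= !mmapXi !mmapC.
Qed.

Lemma on_curveP x : on_curve f curve_eqns x <-> is_point x /\ on_quadrics (f alpha) x.
Proof.
rewrite /on_curve /on_quadrics; split=> -[px h]; split=> //.
  by rewrite -mmap_quadric0 -mmap_quadric1; split; apply: h; rewrite !inE eqxx ?orbT.
by case: h => h1 h2 q; rewrite !inE => /orP[] /eqP ->; rewrite ?mmap_quadric0 ?mmap_quadric1.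
Qed.

Lemma pair_vecl x y j : pair_vec x y (lshift 4 j) = x j.
Proof. by rewrite /pair_vec (unsplitK (inl j)). Qed.
Lemma pair_vecr x y j : pair_vec x y (rshift 4 j) = y j.
Proof. by rewrite /pair_vec (unsplitK (inr j)). Qed.

Lemma mmap_add_formula b x y j :
  mmap f (pair_vec x y) (tnth (add_formula b) j) =
  tnth (segre (f alpha) (f i) (add_law b (f alpha) x y)) j.
Proof.
elim/ord4_ind: j; case: b; rewrite /add_formula /= !tnth_ord4.
all: rewrite !(rmorphN, rmorphD, rmorphM) /= !mmapC !mmapXi.
all: by rewrite !(pair_vecl, pair_vecr).
Qed.

Lemma mmap_opp_formula x j :
  mmap f x (tnth opp_formula j) = tnth [tuple x i1; x i0; x i3; x i2] j.
Proof. by elim/ord4_ind: j; rewrite /opp_formula !tnth_ord4 mmapXi. Qed.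

Lemma mmap_tau_formula x j :
  mmap f x (tnth tau_formula j) = tnth [tuple x i1; x i0; x i3; - x i2] j.
Proof. by elim/ord4_ind: j; rewrite /tau_formula !tnth_ord4 ?rmorphN /= mmapXi. Qed.

Lemma value_seq1 (G : 4.-tuple (mpoly 4 k)) x w (y : 'I_4 -> T) :
  (forall j, mmap f x (tnth G j) = y j) ->
  (value f [:: G] x w <-> is_point y /\ same_point y w).
Proof.
move=> e; split=> [[G']|[py sw]].
  rewrite inE => /eqP -> [pG sG]; split; first exact: is_point_same (eq_same_point e) pG.
  exact: same_point_trans (same_point_sym (eq_same_point e)) sG.
exists G; rewrite ?inE ?eqxx //; split.
  exact: is_point_same (same_point_sym (eq_same_point e)) py.
exact: same_point_trans (eq_same_point e) sw.
Qed.

End Eval.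
End Formulas.

(** * The group law on the points over a field *)

Section ValueField.
Variables (k : fieldType) (alpha i : k).
Variables (L : fieldType) (f : {rmorphism k -> L}).
Hypotheses (two_neq0' : 2%:R != 0 :> k) (im2' : i ^+ 2 = -1).
Hypotheses (al0' : alpha != 0) (al1' : 1 - alpha != 0) (alN1' : 1 + alpha != 0).
Implicit Types (x y z w : 'I_4 -> L) (p q r s : bipoint L).

Let al := f alpha.
Let im := f i.
Let two_neq0 : 2%:R != 0 :> L. Proof. by rewrite -(rmorph_nat f) fmorph_eq0. Qed.
Let im2 : im ^+ 2 = -1. Proof. by rewrite -rmorphXn im2' rmorphN1. Qed.
Let al0 : al != 0. Proof. by rewrite fmorph_eq0. Qed.
Let al1 : 1 - al != 0. Proof. by rewrite -(rmorph1 f) -rmorphB fmorph_eq0. Qed.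
Let alN1 : 1 + al != 0. Proof. by rewrite -(rmorph1 f) -rmorphD fmorph_eq0. Qed.

Let E x := on_curve f (curve_eqns alpha) x.
Let pnt := segre_pt al im.

Definition represents p x := [/\ bip_valid p, on_edwards al p & same_point (pnt p) x].

Lemma on_quadrics_scale u x y : (forall j, y j = u * x j) -> on_quadrics al x ->
    on_quadrics al y.
Proof.
rewrite /on_quadrics /quadric0 /quadric1 => e [h1 h2]; rewrite !e; split.
  by transitivity (u ^+ 2 * quadric0 al x); [rewrite /quadric0;
      ring | rewrite /quadric0 h1 mulr0].
by transitivity (u ^+ 2 * quadric1 al x); [rewrite /quadric1;
    ring | rewrite /quadric1 h2 mulr0].
Qed.

Lemma curve_repP x : E x <-> exists p, represents p x.
Proof.
rewrite /E on_curveP; split=> [[px Ex]|[p [vp Ep [u uu e]]]].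
  have [p [vp Ep e]] := segre_ptP two_neq0 im2 al0 Ex px.
  by exists p; split=> //; apply: eq_same_point.
split; last exact: on_quadrics_scale e (segre_pt_on im2 Ep).
by apply: (@is_point_same _ (pnt p)); [exists u | apply/(segre_pt_is_point two_neq0 im2 al0)].
Qed.

Definition curve_sum x y w := value f (group_add (sklyanin_curve alpha i)) (pair_vec x y) w.

Lemma value_add x y w :
  curve_sum x y w <-> exists b, is_point (pnt (add_law b al x y)) /\
    same_point (pnt (add_law b al x y)) w.
Proof.
have e b : (fun j => mmap f (pair_vec x y) (tnth (add_formula alpha i b) j)) =1
    pnt (add_law b al x y).
  by move=> j; rewrite mmap_add_formula.
split=> [[G]|[b [pb sb]]].
  rewrite /= !inE => memG [pG sG].
  have {memG} [b Gb] : exists b, G = add_formula alpha i b.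
    by case/orP: memG => /eqP ->; [exists true | exists false].
  rewrite {}Gb in pG sG; exists b; split.
    exact: is_point_same (eq_same_point (e b)) pG.
  exact: same_point_trans (same_point_sym (eq_same_point (e b))) sG.
exists (add_formula alpha i b) => /=; first case: b {pb sb}.
  - exact: mem_head.
  - by rewrite in_cons; apply/orP; right; apply: mem_head.
split; first exact: is_point_same (same_point_sym (eq_same_point (e b))) pb.
exact: same_point_trans (eq_same_point (e _)) sb.
Qed.

(** The addition laws in P^3 are those on P^1 x P^1 followed by the Segre map. *)
Lemma add_law_pt b p q x y : represents p x -> represents q y ->
  same_point (pnt (bip_add b al p q)) (pnt (add_law b al x y)).
Proof.
move=> [_ _ [u uu ex]] [_ _ [v vv ey]].
case: p q ex ey => x1 z1 y1 t1 [x2 z2 y2 t2] ex ey.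
(* A law is quadratic in each argument, and its two factors pick up 2 each for [true]
   and 2 alpha^2 each for [false]. *)
exists (if b then 2%:R * 2%:R * (u * v) ^+ 2 else 2%:R * 2%:R * al ^+ 4 * (u * v) ^+ 2).
  move: uu vv; rewrite !unitfE => u0 v0.
  by case: b; rewrite !(mulf_neq0, expf_neq0).
by apply: ord4_ind; case: b; rewrite /pnt /segre_pt /= !tnth_ord4 !ex !ey /pnt /segre_pt /= !tnth_ord4; ring: im2.
Qed.

Lemma curve_sumP p q x y w : represents p x -> represents q y ->
  curve_sum x y w <-> exists b, bip_valid (bip_add b al p q) /\
    same_point (pnt (bip_add b al p q)) w.
Proof.
move=> Rx Ry; rewrite value_add; split=> -[b [pb sb]]; exists b;
 have h := add_law_pt b Rx Ry; split.
- by apply/(segre_pt_is_point two_neq0 im2 al0); apply: is_point_same (same_point_sym h) pb.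
- exact: same_point_trans h sb.
- by apply: is_point_same h _; apply/(segre_pt_is_point two_neq0 im2 al0).
- exact: same_point_trans (same_point_sym h) sb.
Qed.

Lemma curve_sum_defined p q x y : represents p x -> represents q y ->
  exists b, bip_valid (bip_add b al p q).
Proof.
move=> Rx Ry.
have /on_curveP [px Ex] : E x by apply/curve_repP; exists p.
have /on_curveP [py Ey] : E y by apply/curve_repP; exists q.
have [b vb] := add_law_cover two_neq0 al0 al1 alN1 Ex Ey px py.
exists b; apply/(segre_pt_is_point two_neq0 im2 al0);
    apply: is_point_same (same_point_sym (add_law_pt b Rx Ry)) _.
by apply/(segre_pt_is_point two_neq0 im2 al0).
Qed.

Lemma represents_add p q x y b : represents p x -> represents q y ->
    bip_valid (bip_add b al p q) ->
  forall w, same_point (pnt (bip_add b al p q)) w -> represents (bip_add b al p q) w.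
Proof. by move=> [_ Ep _] [_ Eq _] v w s; split=> //; apply: bip_add_on. Qed.

(** By covering, some law is defined at the pair; hence equality with [r] has to be
    checked only for the laws, as formal identities. *)
Lemma curve_sum_intro p q r x y w : represents p x -> represents q y -> represents r w ->
  (forall b, bip_valid (bip_add b al p q) -> bip_eq (bip_add b al p q) r) -> curve_sum x y w.
Proof.
move=> Rx Ry [vr _ sr] h; have [b vb] := curve_sum_defined Rx Ry.
apply/(curve_sumP _ Rx Ry); exists b; split=> //.
by apply: same_point_trans sr; apply: segre_of_bip_eq => //; apply: h.
Qed.

Lemma curve_sum_unique x y w w' : E x -> E y -> curve_sum x y w -> curve_sum x y w' ->
    same_point w w'.
Proof.
move=> /curve_repP[p Rx] /curve_repP[q Ry] /(curve_sumP _ Rx Ry)[b [vb sb]] /(curve_sumP _ Rx Ry)[b' [vb' sb']].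
apply: same_point_trans (same_point_sym sb) _; apply: same_point_trans sb'.
by apply: segre_of_bip_eq => //; apply: bip_add_agree; [case: Rx | case: Ry].
Qed.

Lemma curve_sum_on x y w : E x -> E y -> curve_sum x y w -> E w.
Proof.
move=> /curve_repP[p Rx] /curve_repP[q Ry] /(curve_sumP _ Rx Ry)[b [vb sb]].
by apply/curve_repP; exists (bip_add b al p q); apply: represents_add Rx Ry _ _ _.
Qed.

(** All four additions may use different laws; [bip_addA] treats them alike. *)
Lemma curve_sumA x y z xy yz xyz : E x -> E y -> E z ->
  curve_sum x y xy -> curve_sum y z yz -> curve_sum xy z xyz -> curve_sum x yz xyz.
Proof.
move=> /curve_repP[p Rx] /curve_repP[q Ry] /curve_repP[r Rz].
move=> /(curve_sumP _ Rx Ry)[b1 [v1 s1]] /(curve_sumP _ Ry Rz)[b2 [v2 s2]].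
have Rxy := represents_add Rx Ry v1 s1; have Ryz := represents_add Ry Rz v2 s2.
move=> /(curve_sumP _ Rxy Rz)[b3 [v3 s3]].
apply: (curve_sum_intro Rx Ryz (represents_add Rxy Rz v3 s3)) => b4 _.
apply: bip_eq_sym; apply: bip_addA; [by case: Rx | by case: Ry | by case: Rz].
Qed.

Lemma represents_neutral : represents (bip0 L) (fun j => f (neutral i j)).
Proof.
split; last 1 first.
- exists al^-1; first by rewrite unitfE invr_neq0.
  by apply: ord4_ind; rewrite /pnt /segre_pt /neutral /= !tnth_ord4 ?rmorph1 -/im; field.
- by split=> /=; rewrite oner_eq0; right.
- exact: bip0_on.
Qed.

Lemma represents_tau_pt : represents (Bipoint al 1 1 0) (fun j => f (tau_pt i j)).
Proof.
split; last 1 first.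
- exists al^-1; first by rewrite unitfE invr_neq0.
  by apply: ord4_ind; rewrite /pnt /segre_pt /tau_pt /= !tnth_ord4 ?rmorphN ?rmorph1 -/im;
      field.
- by split=> /=; rewrite oner_eq0; [right|left].
- by rewrite /=; ring.
Qed.

Lemma represents_opp p x : represents p x -> represents (bip_opp p) (tnth [tuple x i1; x i0;
    x i3; x i2]).
Proof.
case: p => x1 z1 y1 t1 [v Ep [u uu e]]; split.
- by move: v; rewrite /bip_valid /= oppr_eq0.
- exact: bip_opp_on.
- exists u => //; apply: ord4_ind; rewrite !tnth_ord4 !e /pnt /segre_pt /= !tnth_ord4; ring.
Qed.

(** The image of a Segre point is alpha^-1 times the Segre point of [bip_tau]. *)
Lemma represents_tau p x : represents p x -> represents (bip_tau al p) (tnth [tuple x i1;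
    x i0; x i3; - x i2]).
Proof.
case: p => x1 z1 y1 t1 [v Ep [u uu e]]; split.
- move: v; rewrite /bip_valid /= oppr_eq0 !mulf_eq0 !(negPf al0) /=; tauto.
- exact: bip_tau_on.
- move: (uu); rewrite unitfE => u0; exists (u / al);
    first by rewrite unitfE mulf_neq0 ?invr_neq0.
  by apply: ord4_ind; rewrite !tnth_ord4 !e /pnt /segre_pt /= !tnth_ord4; field: im2.
Qed.

Lemma maps_to_linear (G : 4.-tuple (mpoly 4 k)) (F : ('I_4 -> L) -> 'I_4 -> L) :
  (forall x j, mmap f x (tnth G j) = F x j) ->
  (forall x p, represents p x -> exists q, represents q (F x)) ->
  maps_to f [:: G] E E.
Proof.
move=> e h x Ex; have /curve_repP[p Rx] := Ex; have [q Rq] := h _ _ Rx.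
have v1 w := value_seq1 w (e x).
have /on_curveP[pq _] : E (F x) by apply/curve_repP; exists q.
split; first by exists (F x); apply/v1; split=> //; apply: eq_same_point.
move=> w /v1[_ s]; split.
  by apply/curve_repP; exists q; case: Rq => ? ? ?; split=> //; apply: same_point_trans s.
by move=> w' /v1[_ s']; apply: same_point_trans (same_point_sym s) s'.
Qed.

Lemma group_laws :
  let o := fun j => f (neutral i j) in
  [/\ maps_to f (group_add (sklyanin_curve alpha i)) (fun v =>
      exists x y, [/\ E x, E y & v = pair_vec x y]) E,
      maps_to f [:: opp_formula k] E E,
      forall x y z xy yz xyz, E x -> E y -> E z ->
        curve_sum x y xy -> curve_sum y z yz -> curve_sum xy z xyz -> curve_sum x yz xyz,
      forall x, E x -> curve_sum o x x /\ curve_sum x o x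
    & forall x x', E x -> value f [:: opp_formula k] x x' ->
        curve_sum x x' o /\ curve_sum x' x o].
Proof.
move=> o; split.
- move=> v [x [y [Ex Ey ->]]]; split.
    have /curve_repP[p Rx] := Ex; have /curve_repP[q Ry] := Ey.
    have [b vb] := curve_sum_defined Rx Ry; exists (pnt (bip_add b al p q)).
    by apply/(curve_sumP _ Rx Ry); exists b; split=> //; apply: eq_same_point.
  move=> w sw; split; first exact: curve_sum_on sw.
  by move=> w' sw'; apply: (curve_sum_unique Ex Ey sw sw').
- apply: (maps_to_linear (@mmap_opp_formula _ _ f)) => x p /represents_opp;
    by exists (bip_opp p).
- exact: curve_sumA.
- move=> x /curve_repP[p Rx]; have [_ Ep _] := Rx; split.
    by apply: (curve_sum_intro represents_neutral Rx Rx) => b _; apply: bip_add0p.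
  by apply: (curve_sum_intro Rx represents_neutral Rx) => b _; apply: bip_addp0.
- move=> x x' /curve_repP[p Rx] /(value_seq1 _ (mmap_opp_formula f x))[_ sx'].
  have [_ Ep _] := Rx; have [? ? s] := represents_opp Rx.
  have Rx' : represents (bip_opp p) x' by split=> //; apply: same_point_trans sx'.
  split; first by apply: (curve_sum_intro Rx Rx' represents_neutral) => b _; apply: bip_addpN.
  by apply: (curve_sum_intro Rx' Rx represents_neutral) => b _; apply: bip_addNp.
Qed.

Lemma translation_law :
  maps_to f [:: tau_formula k] E E /\
  forall x y, E x -> (value f [:: tau_formula k] x y <-> curve_sum x (fun j =>
      f (tau_pt i j)) y).
Proof.
split.
  by apply: (maps_to_linear (@mmap_tau_formula _ _ f)) => x p /represents_tau;
      exists (bip_tau al p).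
move=> x y Ex; rewrite (value_seq1 _ (mmap_tau_formula f x)).
have /curve_repP[p Rx] := Ex; have Rt := represents_tau Rx; have [_ Ep _] := Rx.
set tx := tnth _ in Rt *.
have st : curve_sum x (fun j => f (tau_pt i j)) tx.
  by apply: (curve_sum_intro Rx represents_tau_pt Rt) => b _; apply: bip_add_tau.
have Ep' : E (fun j => f (tau_pt i j)) by apply/curve_repP; eexists; apply: represents_tau_pt.
split=> [[ptx sxy]|sy].
  apply/value_add; move/value_add: st => [b [pb sb]]; exists b; split=> //.
  exact: same_point_trans sxy.
split; last exact: curve_sum_unique Ex Ep' st sy.
by have /on_curveP[] : E tx by apply/curve_repP; eexists; apply: Rt.
Qed.

End ValueField.

(** * A normal form in the coordinate ring of the curve *)

Section LinearExtension.
Variables (n : nat) (K : fieldType) (V : lmodType K) (phi : multinom n -> V).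

Definition lin_ext (p : mpoly n K) : V := \sum_(m <- msupp p) p@_m *: phi m.

(** Summing over any larger finite set of monomials gives additivity. *)
Lemma lin_extw (s : seq (multinom n)) p : uniq s -> {subset msupp p <= s} ->
  lin_ext p = \sum_(m <- s) p@_m *: phi m.
Proof.
move=> us sub; rewrite /lin_ext [RHS](bigID (mem (msupp p))) /=.
rewrite [X in _ + X]big1 ?addr0 => [|m /memN_msupp_eq0 ->]; last by rewrite scale0r.
rewrite -[RHS]big_filter; apply: perm_big; apply: uniq_perm;
    rewrite ?msupp_uniq ?filter_uniq //.
by move=> m; rewrite mem_filter; case: (boolP (m \in msupp p)) => // /sub ->.
Qed.

Lemma lin_ext_is_linear : linear lin_ext.
Proof.
move=> c p q; set s := undup (msupp p ++ msupp q).
have us : uniq s by rewrite undup_uniq.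
have sp : {subset msupp p <= s} by move=> m; rewrite mem_undup mem_cat => ->.
have sq : {subset msupp q <= s} by move=> m; rewrite mem_undup mem_cat => ->; rewrite orbT.
have spq : {subset msupp (c *: p + q) <= s}.
  move=> m; apply: contraTT => ms; rewrite mcoeff_msupp negbK mcoeffD mcoeffZ.
  rewrite !memN_msupp_eq0 ?mulr0 ?addr0 //; apply: contra ms; [exact: sq|exact: sp].
rewrite !(@lin_extw s) // scaler_sumr -big_split; apply: eq_bigr => m _ /=.
by rewrite mcoeffD mcoeffZ scalerDl scalerA.
Qed.

HB.instance Definition _ := GRing.isLinear.Build K (mpoly n K) V _ lin_ext lin_ext_is_linear.

Lemma lin_extX m : lin_ext 'X_[m] = phi m.
Proof. by rewrite /lin_ext msuppX big_seq1 mcoeffX eqxx scale1r. Qed.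

End LinearExtension.

Local Notation expo := (bool * bool * nat)%type.

(** [(e0, e1, j)] stands for the monomial x0^e0 x1^e1 x2^(n - e0 - e1 - j) x3^j of
    degree [n]; a list of them is used because it makes the count 4n visible. *)
Definition basis_expos n : seq expo :=
  [seq (false, false, j) | j <- iota 0 n.+1] ++ [seq (true, false, j) | j <- iota 0 n] ++
  [seq (false, true, j) | j <- iota 0 n] ++ [seq (true, true, j) | j <- iota 0 n.-1].

Lemma size_expos n : (0 < n)%N -> size (basis_expos n) = (4 * n)%N.
Proof. by rewrite !size_cat !size_map !size_iota; lia. Qed.

Lemma mem_expo_map (e e' f f' : bool) (j : nat) (s : seq nat) :
  ((e, e', j) \in [seq (f, f', l) : expo | l <- s]) = ((e, e') == (f, f')) && (j \in s).
Proof.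
apply/mapP/andP => [[l ls [-> -> ->]]|[/eqP[-> ->] js]]; last by exists j.
by rewrite eqxx.
Qed.

Lemma mem_expos n e0 e1 j : ((e0, e1, j) \in basis_expos n) = (e0 + e1 + j <= n)%N.
Proof.
rewrite !mem_cat !mem_expo_map !mem_iota.
by case: e0; case: e1; rewrite /= ?orbF; lia.
Qed.

Lemma uniq_expos n : uniq (basis_expos n).
Proof.
have inj e e' : injective (fun j : nat => (e, e', j) : expo) by move=> ? ? [].
have dis (e e' f f' : bool) s t : (e, e') != (f, f') ->
    has (mem [seq (f, f', j) : expo | j <- t]) [seq (e, e', j) | j <- s] = false.
  move=> ne; apply/hasP => -[x /mapP[j _ ->]].
  by rewrite /= mem_expo_map (negPf ne).
by rewrite /basis_expos !cat_uniq !has_cat !(map_inj_uniq (@inj _ _)) !iota_uniq !dis.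
Qed.

Definition basis_mnm n (t : expo) : multinom 4 :=
  Multinom [tuple t.1.1 : nat; t.1.2 : nat; n - (t.1.1 + t.1.2 + t.2); t.2]%N.

Lemma basis_mnmE n t : (basis_mnm n t i0 = t.1.1) * (basis_mnm n t i1 = t.1.2) *
  (basis_mnm n t i2 = (n - (t.1.1 + t.1.2 + t.2))%N) * (basis_mnm n t i3 = t.2).
Proof. by rewrite !multinomE !tnth_ord4. Qed.

Lemma mdeg_basis_mnm n t : t \in basis_expos n -> mdeg (basis_mnm n t) = n.
Proof.
case: t => [[e0 e1] j]; rewrite mem_expos => le_n.
by rewrite mdegE big_ord4 /= !basis_mnmE /=; lia.
Qed.

Section NormalForm.
Variables (K : fieldType) (al : K).
Hypothesis two_neq0 : 2%:R != 0 :> K.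
Implicit Types (g h : mpoly 4 K) (m : multinom 4).

Definition Q0 : mpoly 4 K := quadric0 al%:MP (fun j => 'X_j).
Definition Q1 : mpoly 4 K := quadric1 al%:MP (fun j => 'X_j).

Lemma mpolyX2 m j : 'X_[m + U_(j) *+ 2] = 'X_[m] * 'X_j ^+ 2 :> mpoly 4 K.
Proof. by rewrite mpolyXn -mpolyXD. Qed.

Lemma mulX_Q0 m : 'X_[m] * Q0 =
  2%:R *: 'X_[m + U_(i0) *+ 2] + (1 + al) *: 'X_[m + U_(i2) *+ 2] + (1 - al) *: 'X_[m +
      U_(i3) *+ 2].
Proof.
rewrite /Q0 /quadric0 !mpolyX2 -!mul_mpolyC !rmorph_nat !(rmorphN, rmorphD) rmorph1.
by ring.
Qed.

Lemma mulX_Q1 m : 'X_[m] * Q1 =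
  2%:R *: 'X_[m + U_(i1) *+ 2] + (1 - al) *: 'X_[m + U_(i2) *+ 2] + (1 + al) *: 'X_[m +
      U_(i3) *+ 2].
Proof.
rewrite /Q1 /quadric1 !mpolyX2 -!mul_mpolyC !rmorph_nat !(rmorphN, rmorphD) rmorph1.
by ring.
Qed.

(** The values of (x0 / x2)^2 and (x1 / x2)^2 on the curve, in terms of x3 / x2. *)
Definition sqx0 : {poly K} := - 2%:R^-1 *: ((1 + al)%:P + (1 - al) *: 'X^2).
Definition sqx1 : {poly K} := - 2%:R^-1 *: ((1 - al)%:P + (1 + al) *: 'X^2).

Lemma sqx0E : 2%:R *: sqx0 + (1 + al) *: 1 + (1 - al) *: 'X^2 = 0.
Proof. by rewrite /sqx0 scalerA mulrN mulfV // scaleN1r alg_polyC -addrA addNr. Qed.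
Lemma sqx1E : 2%:R *: sqx1 + (1 - al) *: 1 + (1 + al) *: 'X^2 = 0.
Proof. by rewrite /sqx1 scalerA mulrN mulfV // scaleN1r alg_polyC -addrA addNr. Qed.

(** The coefficient of x0^e0 x1^e1 when a monomial, restricted to x2 = 1, is written
    in the basis 1, x0, x1, x0 x1 over the polynomials in x3.  For a fixed degree
    nothing is lost by setting x2 = 1. *)
Definition nf_mon (e0 e1 : bool) m : {poly K} :=
  if (odd (m i0) == e0) && (odd (m i1) == e1)
  then sqx0 ^+ (m i0)./2 * sqx1 ^+ (m i1)./2 * 'X^(m i3) else 0.

Definition nf e0 e1 := lin_ext (nf_mon e0 e1).
HB.instance Definition _ e0 e1 := GRing.Linear.copy (nf e0 e1) (lin_ext (nf_mon e0 e1)).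

Lemma nfX e0 e1 m : nf e0 e1 'X_[m] = nf_mon e0 e1 m.
Proof. exact: lin_extX. Qed.

Lemma mnm2E m j l : (m + U_(j) *+ 2)%MM l = (m l + (j == l).*2)%N.
Proof. by rewrite mnmDE mulmnE mnm1E muln2. Qed.

Lemma nf_Q0 e0 e1 g : nf e0 e1 (g * Q0) = 0.
Proof.
rewrite [g]mpolyE mulr_suml raddf_sum /= big1 // => m _.
rewrite -scalerAl linearZ /= mulX_Q0 !linearD !linearZ /= !nfX /nf_mon !mnm2E.
rewrite !neq_ord4 !eqxx !addn0 !oddD !odd_double !addbF.
case: ifP => _; last by rewrite !(scaler0, addr0).
rewrite halfD !odd_double andbF add0n doubleK addn1 exprS exprD.
set a := sqx0 ^+ _; set b := sqx1 ^+ _; set x := 'X^(m i3).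
transitivity (g@_m *: ((2%:R *: sqx0 + (1 + al) *: 1 + (1 - al) *: 'X^2) * (a * b * x))).
  by rewrite -!mul_polyC; ring.
by rewrite sqx0E mul0r scaler0.
Qed.

Lemma nf_Q1 e0 e1 g : nf e0 e1 (g * Q1) = 0.
Proof.
rewrite [g]mpolyE mulr_suml raddf_sum /= big1 // => m _.
rewrite -scalerAl linearZ /= mulX_Q1 !linearD !linearZ /= !nfX /nf_mon !mnm2E.
rewrite !neq_ord4 !eqxx !addn0 !oddD !odd_double !addbF.
case: ifP => _; last by rewrite !(scaler0, addr0).
rewrite halfD !odd_double andbF add0n doubleK addn1 exprS exprD.
set a := sqx0 ^+ _; set b := sqx1 ^+ _; set x := 'X^(m i3).
transitivity (g@_m *: ((2%:R *: sqx1 + (1 - al) *: 1 + (1 + al) *: 'X^2) * (a * b * x))).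
  by rewrite -!mul_polyC; ring.
by rewrite sqx1E mul0r scaler0.
Qed.

Lemma nf_eval g (x : 'I_4 -> K) : on_quadrics al x -> x i2 = 1 ->
  g.@[x] = \sum_(e0 : bool) \sum_(e1 : bool) (nf e0 e1 g).[x i3] * x i0 ^+ e0 * x i1 ^+ e1.
Proof.
rewrite /on_quadrics /quadric0 /quadric1 => -[h1 h2] x2; rewrite x2 expr1n !mulr1 in h1 h2.
have A : sqx0.[x i3] = x i0 ^+ 2.
  apply: (mulfI two_neq0); apply: subr0_eq;
      rewrite /sqx0 hornerZ hornerD hornerC hornerZ hornerXn -[RHS]oppr0 -h1.
   by field.
have B : sqx1.[x i3] = x i1 ^+ 2.
  apply: (mulfI two_neq0); apply: subr0_eq;
      rewrite /sqx1 hornerZ hornerD hornerC hornerZ hornerXn -[RHS]oppr0 -h2.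
  by field.
transitivity (\sum_(m <- msupp g) g@_m *
  \sum_(e0 : bool) \sum_(e1 : bool) (nf_mon e0 e1 m).[x i3] * x i0 ^+ e0 * x i1 ^+ e1).
{ rewrite {1}[g]mpolyE raddf_sum /=; apply: eq_bigr => m _.
  rewrite mevalZ mevalX big_ord4 /= x2 expr1n mul1r; congr (_ * _).
  rewrite !big_bool /nf_mon.
  case o0: (odd (m i0)); case o1: (odd (m i1)) => /=.
  all: rewrite ?horner0 !hornerM !horner_exp hornerX A B !(mul0r, addr0, add0r).
  all: rewrite -{1}(odd_double_half (m i0)) -{1}(odd_double_half (m i1))
      o0 o1 -!exprM !mul2n /=.
  all: by rewrite ?(exprS _ (_.*2)) ?add0n ?add1n ?exprS; ring. }
rewrite /nf /lin_ext !big_bool /= !horner_sum !mulr_suml -!big_split /=.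
by apply: eq_bigr => m _; rewrite !hornerZ; rewrite !big_bool /=; ring.
Qed.

Definition in_curve_ideal g := exists a b, g = a * Q0 + b * Q1.

Lemma in_curve_idealD g h : in_curve_ideal g -> in_curve_ideal h -> in_curve_ideal (g + h).
Proof. by move=> [a [b ->]] [c [d ->]]; exists (a + c), (b + d); ring. Qed.
Lemma in_curve_idealZ c g : in_curve_ideal g -> in_curve_ideal (c *: g).
Proof. by move=> [a [b ->]]; exists (c *: a), (c *: b); rewrite -!scalerAl scalerDr. Qed.
Lemma in_curve_ideal0 : in_curve_ideal 0. Proof. by exists 0, 0; rewrite !mul0r addr0. Qed.

Lemma nf_ideal e0 e1 g : in_curve_ideal g -> nf e0 e1 g = 0.
Proof. by case=> a [b ->]; rewrite linearD /= nf_Q0 nf_Q1 addr0. Qed.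

Lemma nf_basis_mnm e0 e1 n t :
  nf e0 e1 'X_[basis_mnm n t] = ((t.1 == (e0, e1))%:R : K) *: 'X^(t.2).
Proof.
rewrite nfX /nf_mon !basis_mnmE; case: t => [[f0 f1] j] /=.
by case: f0 f1 e0 e1 => [] [] [] [] /=; rewrite ?scale0r // ?expr0 ?mul1r scale1r.
Qed.

Definition spanned n g := exists c : expo -> K,
  in_curve_ideal (g - \sum_(t <- basis_expos n) c t *: 'X_[basis_mnm n t]).

Lemma spannedD n g h : spanned n g -> spanned n h -> spanned n (g + h).
Proof.
case=> c Ic [d Id]; exists (fun t => c t + d t).
have -> : \sum_(t <- basis_expos n) (c t + d t) *: 'X_[basis_mnm n t] =
  \sum_(t <- basis_expos n) c t *: 'X_[basis_mnm n t] + \sum_(t <- basis_expos n)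
      d t *: 'X_[basis_mnm n t].
  by rewrite -big_split; apply: eq_bigr => t _; rewrite scalerDl.
by rewrite opprD addrACA; apply: in_curve_idealD.
Qed.

Lemma spannedZ n a g : spanned n g -> spanned n (a *: g).
Proof.
case=> c Ic; exists (fun t => a * c t).
have -> : \sum_(t <- basis_expos n) (a * c t) *: 'X_[basis_mnm n t] =
  a *: \sum_(t <- basis_expos n) c t *: 'X_[basis_mnm n t].
  by rewrite scaler_sumr; apply: eq_bigr => t _; rewrite scalerA.
by rewrite -scalerBr; apply: in_curve_idealZ.
Qed.

Lemma spanned_ideal n g h : in_curve_ideal (g - h) -> spanned n h -> spanned n g.
Proof.
move=> I [c Ic]; exists c; rewrite -(subrK h g) -addrA; exact: in_curve_idealD.
Qed.

Lemma spanned0 n : spanned n 0.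
Proof.
exists (fun=> 0); rewrite big1 ?subrr => [|t _]; last by rewrite scale0r.
exact: in_curve_ideal0.
Qed.

Lemma spanned_basis_mnm n t : t \in basis_expos n -> spanned n 'X_[basis_mnm n t].
Proof.
move=> tn; exists (fun s => (s == t)%:R).
rewrite (bigD1_seq t) ?uniq_expos //= eqxx scale1r big1 ?addr0 ?subrr => [|s /negPf ->].
  exact: in_curve_ideal0.
by rewrite scale0r.
Qed.

(** While x0 or x1 has exponent at least 2, one of the quadrics replaces the monomial
    by two monomials with a smaller exponent of x0 and x1 together. *)
Lemma spanned_X n m : mdeg m = n -> spanned n 'X_[m].
Proof.
have [l] := ubnP (m i0 + m i1); elim: l m => // l IHl m le_l dm.
have dmE : (m i0 + (m i1 + (m i2 + m i3)) = n)%N by rewrite -dm mdegE big_ord4.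
have two : 2%:R^-1 * 2%:R = 1 :> K by rewrite mulVf.
have step (j : 'I_4) (a b : K) (F : mpoly 4 K) :
    j = i0 \/ j = i1 -> (1 < m j)%N ->
    (forall m', 'X_[m'] * F = 2%:R *: 'X_[m' + U_(j) *+ 2] + a *: 'X_[m' + U_(i2) *+ 2]
       + b *: 'X_[m' + U_(i3) *+ 2]) ->
    (forall g, in_curve_ideal (g * F)) -> spanned n 'X_[m].
  move=> ji mj XF IF; pose m' := (m - U_(j) *+ 2)%MM.
  have mE : (m' + U_(j) *+ 2)%MM = m.
    rewrite submK //; apply/mnm_lepP => i; rewrite mulmnE mnm1E.
    by case: eqP => [<-|_]; rewrite ?mul1n ?mul0n.
  have m'E i : m' i = (m i - (j == i).*2)%N by rewrite mnmBE mulmnE mnm1E muln2.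
  have small i : i = i2 \/ i = i3 -> spanned n 'X_[m' + U_(i) *+ 2].
    move=> ii; apply: IHl; last first.
      by rewrite mdegE big_ord4 /= !mnm2E !m'E; case: ji mj => -> mj; case: ii => ->;
        rewrite !neq_ord4 !eqxx /=; lia.
    by rewrite !mnm2E !m'E; case: ji mj => -> mj; case: ii => ->; rewrite !neq_ord4 !eqxx /=;
        lia.
  apply: (@spanned_ideal n _ (- 2%:R^-1 *: (a *: 'X_[m' + U_(i2) *+ 2] + b *: 'X_[m' + U_(i3)
      *+ 2]))).
    have := XF m'; rewrite mE => XFm.
    rewrite scaleNr opprK.
    have -> : 'X_[m] = 2%:R^-1 *: (2%:R *: 'X_[m]) :> mpoly 4 K.
      by rewrite scalerA two scale1r.
    by rewrite -scalerDr addrA -XFm; apply: in_curve_idealZ.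
  by apply: spannedZ; apply: spannedD; apply: spannedZ; apply: small; [left|right].
have [m0|m0] := ltnP 1 (m i0).
  apply: (step i0 (1 + al) (1 - al) Q0) => //; first by left.
    exact: mulX_Q0.
  by move=> g; exists g, 0; rewrite mul0r addr0.
have [m1|m1] := ltnP 1 (m i1).
  apply: (step i1 (1 - al) (1 + al) Q1) => //; first by right.
    exact: mulX_Q1.
  by move=> g; exists 0, g; rewrite mul0r add0r.
pose t : expo := (m i0 == 1, m i1 == 1, m i3)%N.
have e0 : (m i0 == 1)%N = m i0 :> nat by case: (m i0) m0 => [|[]].
have e1 : (m i1 == 1)%N = m i1 :> nat by case: (m i1) m1 => [|[]].
have -> : m = basis_mnm n t.
  by apply/mnmP; apply: ord4_ind; rewrite !basis_mnmE /= ?e0 ?e1 //; lia.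
by apply: spanned_basis_mnm; rewrite mem_expos e0 e1; lia.
Qed.

Lemma spanned_homog n g : g \is n.-homog -> spanned n g.
Proof.
move/dhomogP => hg; rewrite [g]mpolyE big_seq.
elim/big_ind: _ => [|? ? | m mg]; [exact: spanned0 | exact: spannedD |].
by apply: spannedZ; apply: spanned_X; apply: hg.
Qed.

Lemma nf_span n (c : expo -> K) e0 e1 l : (e0, e1, l) \in basis_expos n ->
  (nf e0 e1 (\sum_(t <- basis_expos n) c t *: 'X_[basis_mnm n t]))`_l = c (e0, e1, l).
Proof.
move=> tn; rewrite raddf_sum /= coef_sum (bigD1_seq _ tn) ?uniq_expos //=.
rewrite linearZ /= nf_basis_mnm eqxx scale1r coefZ coefXn eqxx mulr1 big1 ?addr0 //.
move=> [[f0 f1] j] ne; rewrite linearZ /= nf_basis_mnm !coefZ coefXn /=.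
case: ((f0, f1) =P (e0, e1)) ne => [[-> ->]|_ _]; last by rewrite mul0r mulr0.
have [<-|_ _] := eqVneq l j; first by rewrite eqxx.
by rewrite !mulr0.
Qed.

(** The converse of [nf_ideal] for forms: the normal form separates the residue
    classes of the spanning monomials. *)
Lemma nf_homog_eq0 n g : g \is n.-homog -> (forall e0 e1, nf e0 e1 g = 0) -> in_curve_ideal g.
Proof.
move/spanned_homog => [c Ic] g0.
have c0 : \sum_(t <- basis_expos n) c t *: 'X_[basis_mnm n t] = 0.
  apply: big1_seq => -[[e0 e1] l] /andP[_ tn]; rewrite -(nf_span c tn).
  have /eqP := nf_ideal e0 e1 Ic; rewrite linearB /= g0 sub0r oppr_eq0 => /eqP ->.
  by rewrite coef0 scale0r.
by rewrite c0 subr0 in Ic.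
Qed.

End NormalForm.

(** * The Hilbert polynomial *)

Section Hilbert.
Variables (k : fieldType) (alpha : k).
Hypothesis two_neq0 : 2%:R != 0 :> k.

Lemma in_eq_ideal_pair (p q g : mpoly 4 k) :
  in_eq_ideal [:: p; q] g <-> exists a b, g = a * p + b * q.
Proof.
split=> [[a ->]|[a [b ->]]].
  exists (a ord0), (a ord_max); rewrite !big_ord_recl big_ord0 addr0.
  by congr (_ + a _ * _); apply: val_inj.
exists (fun j => if j == ord0 then a else b).
by rewrite !big_ord_recl big_ord0 addr0.
Qed.

Lemma in_eq_idealP g : in_eq_ideal (curve_eqns alpha) g <-> in_curve_ideal alpha g.
Proof. exact: in_eq_ideal_pair. Qed.

Lemma hilbert_curve : hilbert_polynomial_4t (curve_eqns alpha).
Proof.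
exists 1%N => n n_gt0; have sz := size_expos n_gt0.
pose e0 : expo := (false, false, 0%N).
pose t (j : 'I_(4 * n)) := nth e0 (basis_expos n) j.
have tn j : t j \in basis_expos n by rewrite mem_nth // sz.
have sumE (c : expo -> k) : \sum_j c (t j) *: 'X_[basis_mnm n (t j)] =
    \sum_(s <- basis_expos n) c s *: 'X_[basis_mnm n s].
  by rewrite (big_nth e0) sz big_mkord.
have t_inj j j' : (t j == t j') = (j == j') by rewrite nth_uniq ?sz ?uniq_expos.
exists (fun j => 'X_[basis_mnm n (t j)]); split=> [j|g hg].
  by rewrite dhomogX; apply/eqP; apply: mdeg_basis_mnm.
have [c Ic] := spanned_homog alpha two_neq0 hg.
exists [ffun j => c (t j)]; split.
  apply/in_eq_idealP; rewrite (eq_bigr (fun j => c (t j) *: 'X_[basis_mnm n (t j)])) ?sumE //.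
  by move=> j _; rewrite ffunE.
move=> d /in_eq_idealP Id; apply/ffunP => j; rewrite ffunE.
(* [d] as a function on all exponents, to which [nf_span] applies *)
pose d' s := \sum_(j < 4 * n | t j == s) d j.
have d't l : d' (t l) = d l.
  by rewrite /d' (eq_bigl (pred1 l)) ?big_pred1_eq // => l'; rewrite t_inj.
rewrite -d't; apply/eqP; rewrite -subr_eq0; apply/eqP.
case tj : (t j) (tn j) => [[f0 f1] l] tjn.
rewrite -(nf_span alpha c tjn) -(nf_span alpha d' tjn) -coefB -linearB /=.
rewrite nf_ideal ?coef0 //.
have -> : \sum_(s <- basis_expos n) c s *: 'X_[basis_mnm n s] - \sum_(s <- basis_expos n)
    d' s *: 'X_[basis_mnm n s]
    = (g - \sum_j d j *: 'X_[basis_mnm n (t j)]) + -1 *: (g - \sum_(s <- basis_expos n)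
        c s *: 'X_[basis_mnm n s]) :> mpoly 4 k.
  have -> : \sum_(s <- basis_expos n) d' s *: 'X_[basis_mnm n s] =
      \sum_j d j *: 'X_[basis_mnm n (t j)] :> mpoly 4 k.
    by rewrite -sumE; apply: eq_bigr => l' _; rewrite d't.
  by rewrite scaleN1r opprB [RHS]addrC addrA subrK.
by apply: in_curve_idealD => //; apply: in_curve_idealZ.
Qed.
End Hilbert.

(** * Geometric irreducibility *)

Section NonSquares.
Variable K : fieldType.
Implicit Types p a b : {poly K}.

(** In an equation a^2 = p b^2 the multiplicity of [r] would have both parities. *)
Lemma odd_mup_nonsquare p a b r : p != 0 -> odd (mup r p) ->
  a ^+ 2 = p * b ^+ 2 -> a = 0 /\ b = 0.
Proof.
move=> p0 odd_p e; have [b0|b0] := eqVneq b 0.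
  by split=> //; apply/eqP; rewrite -sqrf_eq0 e b0 expr0n mulr0.
have a0 : a != 0 by rewrite -sqrf_eq0 e mulf_neq0 ?expf_neq0.
have := congr1 (fun q => odd (mup r q)) e.
by rewrite !expr2 !mupM ?mulf_neq0 // !oddD odd_p !addbb.
Qed.

(** The norm of a + b sqrt A + c sqrt B + d sqrt (A B) is P^2 - B Q^2, where P + Q sqrt B is
    its norm over the field generated by sqrt B.  When it vanishes, so do P and Q,
    and squaring a^2 + B c^2 = A (b^2 + B d^2) with a c = A b d shows that
    a^2 - B c^2 is A (b^2 - B d^2) up to sign.  Each sign makes A or A B a ratio of squares. *)
Lemma biquadratic_norm_eq0 (A B a b c d : {poly K}) : 2%:R != 0 :> K ->
  (forall u v : {poly K}, u ^+ 2 = A * v ^+ 2 -> u = 0 /\ v = 0) ->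
  (forall u v : {poly K}, u ^+ 2 = B * v ^+ 2 -> u = 0 /\ v = 0) ->
  (forall u v : {poly K}, u ^+ 2 = A * B * v ^+ 2 -> u = 0 /\ v = 0) ->
  (a ^+ 2 + B * c ^+ 2 - A * b ^+ 2 - A * B * d ^+ 2) ^+ 2
    = B * (2%:R * (a * c - A * b * d)) ^+ 2 ->
  [/\ a = 0, b = 0, c = 0 & d = 0].
Proof.
move=> two_neq0 sA sB sAB /sB [/eqP + /eqP].
have two0 : 2%:R != 0 :> {poly K} by rewrite -polyC_natr polyC_eq0.
have nB : B != 0.
  apply/eqP => B0; have [|_ /eqP] := sB 0 1; first by rewrite B0 mul0r expr0n.
  by rewrite oner_eq0.
rewrite mulf_eq0 (negPf two0) /= !subr_eq0 => /eqP P /eqP Q.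
have P' : a ^+ 2 + B * c ^+ 2 = A * b ^+ 2 + A * B * d ^+ 2 by rewrite -P; ring.
have half (u v : {poly K}) : 2%:R * u = 2%:R * v -> u = v by move/(mulfI two0).
have : (a ^+ 2 - B * c ^+ 2 - A * (b ^+ 2 - B * d ^+ 2)) *
       (a ^+ 2 - B * c ^+ 2 + A * (b ^+ 2 - B * d ^+ 2)) = 0.
  transitivity ((a ^+ 2 + B * c ^+ 2) ^+ 2 - 4%:R * B * (a * c) ^+ 2 -
    ((A * b ^+ 2 + A * B * d ^+ 2) ^+ 2 - 4%:R * B * (A * b * d) ^+ 2)); first by ring.
  by rewrite P' Q subrr.
move/eqP; rewrite mulf_eq0 => /orP[] /eqP e.
- have [-> ->] : a = 0 /\ b = 0.
    apply: sA; apply: half; transitivity ((a ^+ 2 + B * c ^+ 2) + (a ^+ 2 - B * c ^+ 2));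
        first by ring.
    by rewrite P' (subr0_eq e); ring.
  have [-> ->] // : c = 0 /\ d = 0.
  apply: sA; apply: (mulfI nB); apply: half.
  transitivity ((a ^+ 2 + B * c ^+ 2) - (a ^+ 2 - B * c ^+ 2)); first by ring.
  by rewrite P' (subr0_eq e); ring.
- move/eqP: e; rewrite addr_eq0 => /eqP e.
  have [-> ->] : a = 0 /\ d = 0.
    apply: sAB; apply: half; transitivity ((a ^+ 2 + B * c ^+ 2) + (a ^+ 2 - B * c ^+ 2));
        first by ring.
    by rewrite P' e; ring.
  have [/eqP + ->] // : B * c = 0 /\ b = 0.
    apply: sAB; transitivity (B * (B * c ^+ 2)); first by ring.
    have -> : B * c ^+ 2 = A * b ^+ 2; last by ring.
    apply: half; transitivity ((a ^+ 2 + B * c ^+ 2) - (a ^+ 2 - B * c ^+ 2)); first by ring.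
    by rewrite P' e; ring.
  by rewrite mulf_eq0 (negPf nB) => /eqP.
Qed.
End NonSquares.

Section Irreducible.
Variables (L : closedFieldType).
Implicit Types (al : L).
Hypothesis two_neq0 : 2%:R != 0 :> L.

Lemma closed_sqrt (c : L) : exists u, u ^+ 2 = c.
Proof.
have /closed_rootP[u] : size ('X^2 - c%:P : {poly L}) != 1%N by rewrite size_XnsubC.
by rewrite /root !hornerE subr_eq0 => /eqP; exists u.
Qed.

Lemma sqx1_sqx0 al : sqx1 al = sqx0 (- al).
Proof. by rewrite /sqx0 /sqx1 opprK. Qed.

Lemma sqx0_horner al r : (sqx0 al).[r] = - 2%:R^-1 * ((1 + al) + (1 - al) * r ^+ 2).
Proof. by rewrite /sqx0 hornerZ hornerD hornerC hornerZ hornerXn. Qed.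

Lemma sqx0_neq0 al : 1 - al != 0 -> sqx0 al != 0.
Proof.
move=> al1; apply/eqP => /(congr1 (coefp 2)) /=.
rewrite /sqx0 coef0 coefZ coefD coefC coefZ coefXn /= add0r mulr1 => /eqP.
by rewrite mulf_eq0 oppr_eq0 invr_eq0 (negPf two_neq0) (negPf al1).
Qed.

(** The roots are opposite, and nonzero since 1 + alpha is; so they are distinct. *)
Lemma sqx0_simple_root al : 1 - al != 0 -> 1 + al != 0 ->
  exists r, (1 + al) + (1 - al) * r ^+ 2 = 0 /\ mup r (sqx0 al) = 1%N.
Proof.
move=> al1 alN1; have [r r2] := closed_sqrt (- (1 + al) / (1 - al)).
have e : (1 + al) + (1 - al) * r ^+ 2 = 0 by rewrite r2; field.
exists r; split=> //.
have r0 : r != 0 by apply: contraNneq alN1 => r0; rewrite -e r0 expr0n mulr0 addr0.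
have -> : sqx0 al = ('X - r%:P) ^+ 1 * ((- 2%:R^-1 * (1 - al))%:P * ('X - (- r)%:P) ^+ 1).
  have -> : sqx0 al = - 2%:R^-1 *: ((1 - al) *: ('X^2 - (r ^+ 2)%:P)).
    congr (_ *: _); rewrite scalerBr addrC; congr (_ + _).
    by rewrite -mul_polyC -polyCM -polyCN; congr (_%:P); apply: subr0_eq; rewrite opprK.
  rewrite -!mul_polyC mulrA -polyCM polyCN rmorphXn /=; ring.
rewrite mupMl ?mup_XsubCX ?eqxx //.
rewrite rootM expr1 rootC root_XsubC mulf_eq0 oppr_eq0 invr_eq0 (negPf two_neq0) (negPf al1) /=.
by rewrite -subr_eq0 opprK -mulr2n -mulr_natl mulf_neq0.
Qed.

(** The quadratic polynomials [sqx0] and [sqx1] have no common root, because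
    (1 + alpha)^2 - (1 - alpha)^2 = 4 alpha is nonzero. *)
Lemma sq_anisotropic al : al != 0 -> 1 - al != 0 -> 1 + al != 0 ->
  [/\ forall u v : {poly L}, u ^+ 2 = sqx0 al * v ^+ 2 -> u = 0 /\ v = 0,
      forall u v : {poly L}, u ^+ 2 = sqx1 al * v ^+ 2 -> u = 0 /\ v = 0
    & forall u v : {poly L}, u ^+ 2 = sqx0 al * sqx1 al * v ^+ 2 -> u = 0 /\ v = 0].
Proof.
move=> al0 al1 alN1; have [r [r_root mr]] := sqx0_simple_root al1 alN1.
have nA := sqx0_neq0 al1; have nB : sqx1 al != 0 by rewrite sqx1_sqx0 sqx0_neq0 ?opprK.
split=> u v.
- by apply: (odd_mup_nonsquare (r := r)); rewrite ?mr.
- have [||s [_ ms]] := @sqx0_simple_root (- al); rewrite ?opprK //.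
  by apply: (odd_mup_nonsquare (r := s)); rewrite // sqx1_sqx0 ms.
- apply: (odd_mup_nonsquare (r := r)); first exact: mulf_neq0.
  rewrite mupMl ?mr // sqx1_sqx0 /root sqx0_horner opprK mulf_eq0 oppr_eq0 invr_eq0 (negPf two_neq0) /=.
  apply/eqP => e; have : 2%:R * (2%:R * al) = 0.
    transitivity ((1 + al) * ((1 + al) + (1 - al) * r ^+ 2) - (1 - al) * ((1 - al) + (1 + al)
        * r ^+ 2)); first by ring.
    by rewrite e r_root !mulr0 subrr.
  by move/eqP; rewrite !mulf_eq0 (negPf al0) (negPf two_neq0).
Qed.

(** The norm of the normal form of [g]; it is the product of the values of [g] at the
    four points of the curve with x2 = 1 and given x3. *)
Definition norm_poly al (g : mpoly 4 L) : {poly L} :=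
  let a := nf al false false g in let b := nf al true false g in
  let c := nf al false true g in let d := nf al true true g in
  (a ^+ 2 + sqx1 al * c ^+ 2 - sqx0 al * b ^+ 2 - sqx0 al * sqx1 al * d ^+ 2) ^+ 2
    - sqx1 al * (2%:R * (a * c - sqx0 al * b * d)) ^+ 2.

Lemma norm_poly_root al g (x : 'I_4 -> L) : on_quadrics al x -> x i2 = 1 ->
  g.@[x] = 0 -> (norm_poly al g).[x i3] = 0.
Proof.
move=> Ex x2; rewrite (nf_eval two_neq0 _ Ex) // !big_bool /= !expr0 !expr1.
case: Ex; rewrite /quadric0 /quadric1 x2 expr1n !mulr1 => h1 h2.
have A : (sqx0 al).[x i3] = x i0 ^+ 2.
  apply: (mulfI two_neq0); apply: subr0_eq; rewrite sqx0_horner -[RHS]oppr0 -h1.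
  by field.
have B : (sqx1 al).[x i3] = x i1 ^+ 2.
  apply: (mulfI two_neq0); apply: subr0_eq; rewrite sqx1_sqx0 sqx0_horner -[RHS]oppr0 -h2.
  by field.
rewrite /norm_poly; set a := nf _ false false _; set b := nf _ true false _;
  set c := nf _ false true _; set d := nf _ true true _.
move=> e.
rewrite -polyC_natr !(hornerD, hornerN, hornerM, horner_exp) hornerC A B.
move: e; move: (x i0) (x i1) (a.[_]) (b.[_]) (c.[_]) (d.[_]) => u v a' b' c' d' e.
transitivity ((d' * u * v + b' * u + (c' * v + a')) * ((a' - b' * u + c' * v - d' * u * v) *
    (a' + b' * u - c' * v - d' * u * v) * (a' - b' * u - c' * v + d' * u * v))).
  ring.
by rewrite e mul0r.
Qed.

Lemma norm_poly_eq0 al g n : al != 0 -> 1 - al != 0 -> 1 + al != 0 ->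
  g \is n.-homog -> norm_poly al g = 0 -> in_curve_ideal al g.
Proof.
move=> al0 al1 alN1 hg /subr0_eq N0; apply: (nf_homog_eq0 two_neq0 hg).
have [sA sB sAB] := sq_anisotropic al0 al1 alN1.
by have [? ? ? ?] := biquadratic_norm_eq0 two_neq0 sA sB sAB N0; case=> -[].
Qed.

(** Above each value [t] of x3 there is a point of the curve, where [g] or [h]
    vanishes; so the product of the norms vanishes on the infinite field [L]. *)
Lemma vanish_product al (g h : mpoly 4 L) : al != 0 -> 1 - al != 0 -> 1 + al != 0 ->
  (forall x, is_point x -> on_quadrics al x -> (g * h).@[x] = 0) ->
  norm_poly al g = 0 \/ norm_poly al h = 0.
Proof.
move=> al0 al1 alN1 gh.
suff /eqP : norm_poly al g * norm_poly al h = 0.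
  by rewrite mulf_eq0 => /orP[] /eqP; [left | right].
apply/eqP; apply: contraT => /closed_nonrootP[t]; apply: contraR => _.
have [u uE] := closed_sqrt (sqx0 al).[t]; have [v vE] := closed_sqrt (sqx1 al).[t].
pose x : 'I_4 -> L := tnth [tuple u; v; 1; t].
have Ex : on_quadrics al x.
  rewrite /on_quadrics /quadric0 /quadric1 /x !tnth_ord4 uE vE sqx1_sqx0 !sqx0_horner.
  by split; field.
have x2 : x i2 = 1 by rewrite /x !tnth_ord4.
have px : is_point x by exists i2; rewrite x2 unitr1.
have := gh x px Ex; rewrite mevalM => /eqP; rewrite mulf_eq0 rootM.
have xt : x i3 = t by rewrite /x !tnth_ord4.
by case/orP=> /eqP /(norm_poly_root Ex x2); rewrite xt /root => ->; rewrite eqxx ?orbT.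
Qed.

Lemma in_curve_ideal_vanish al g (x : 'I_4 -> L) : in_curve_ideal al g -> on_quadrics al x ->
    g.@[x] = 0.
Proof.
move=> [a [b ->]] [h1 h2].
have e1 : (Q0 al).@[x] = 0 by rewrite -h1; exact: (mmap_quadric0 al idfun x).
have e2 : (Q1 al).@[x] = 0 by rewrite -h2; exact: (mmap_quadric1 al idfun x).
move: (Q0 al) (Q1 al) e1 e2 => p q e1 e2.
by rewrite mevalD !mevalM e1 e2 !mulr0 addr0.
Qed.
End Irreducible.

(** * The elliptic curve, its group law and the point of order 4 *)

Section CurveFacts.
Variables (k : fieldType) (alpha i : k).
Hypotheses (two_neq0 : 2%:R != 0 :> k) (im2 : i ^+ 2 = -1).
Hypotheses (al0 : alpha != 0) (al1 : 1 - alpha != 0) (alN1 : 1 + alpha != 0).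

Lemma two_neq0_rmorph (L : fieldType) (f : {rmorphism k -> L}) : 2%:R != 0 :> L.
Proof. by rewrite -(rmorph_nat f) fmorph_eq0. Qed.

Lemma alpha_rmorph (L : fieldType) (f : {rmorphism k -> L}) :
  [/\ f alpha != 0, 1 - f alpha != 0 & 1 + f alpha != 0].
Proof. by rewrite -(rmorph1 f) -rmorphB -rmorphD !fmorph_eq0. Qed.

Lemma mmap_deriv_sq (L : fieldType) (f : {rmorphism k -> L}) (x : 'I_4 -> L) j l :
  mmap f x ('X_[U_(l) *+ 2] : mpoly 4 k)^`M(j) = (l == j)%:R * (2%:R * x l).
Proof.
rewrite mderivX mmapZ mulmnE mnm1E muln2 rmorph_nat.
have [->|_] := eqVneq l j; last by rewrite !mul0r.
rewrite (_ : (U_(j) *+ 2 - U_(j))%MM = U_(j)%MM) ?mmapXi ?mul1r //.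
by apply/mnmP => m; rewrite mnmBE mulmnE !mnm1E muln2 -addnn addnK.
Qed.

Lemma mmap_deriv_Q0 (L : fieldType) (f : {rmorphism k -> L}) x j :
  mmap f x (Q0 alpha)^`M(j) = 2%:R * ((i0 == j)%:R * (2%:R * x i0)) +
    (1 + f alpha) * ((i2 == j)%:R * (2%:R * x i2)) + (1 - f alpha)
        * ((i3 == j)%:R * (2%:R * x i3)).
Proof.
rewrite -[Q0 alpha]mul1r -mpolyX0 mulX_Q0 !add0m !mderivD !mderivZ !rmorphD /=.
by rewrite !mmapZ !mmap_deriv_sq rmorph_nat !(rmorphN, rmorphD) rmorph1.
Qed.

Lemma mmap_deriv_Q1 (L : fieldType) (f : {rmorphism k -> L}) x j :
  mmap f x (Q1 alpha)^`M(j) = 2%:R * ((i1 == j)%:R * (2%:R * x i1)) +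
    (1 - f alpha) * ((i2 == j)%:R * (2%:R * x i2)) + (1 + f alpha)
        * ((i3 == j)%:R * (2%:R * x i3)).
Proof.
rewrite -[Q1 alpha]mul1r -mpolyX0 mulX_Q1 !add0m !mderivD !mderivZ !rmorphD /=.
by rewrite !mmapZ !mmap_deriv_sq rmorph_nat !(rmorphN, rmorphD) rmorph1.
Qed.

Lemma curve_irreducible : geometrically_irreducible (curve_eqns alpha).
Proof.
move=> L f g h d d' hg hh gh; have two := two_neq0_rmorph f.
have [a0 a1 aN1] := alpha_rmorph f.
have gh' x : is_point x -> on_quadrics (f alpha) x -> (g * h).@[x] = 0.
  by move=> px Ex; apply: gh; apply/on_curveP.
have [N0|N0] := vanish_product two a0 a1 aN1 gh'; [left|right] => x /on_curveP[_ Ex].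
  exact: in_curve_ideal_vanish (norm_poly_eq0 two a0 a1 aN1 hg N0) Ex.
exact: in_curve_ideal_vanish (norm_poly_eq0 two a0 a1 aN1 hh N0) Ex.
Qed.

(** A linear relation between the gradients (x0, 0, ..) and (0, x1, ..) forces two
    coordinates to vanish. *)
Lemma curve_smooth : smooth_curve (curve_eqns alpha).
Proof.
move=> L f x /on_curveP[px Ex]; have two := two_neq0_rmorph f.
have [a0 a1 aN1] := alpha_rmorph f; set al := f alpha in Ex a0 a1 aN1.
set J := \matrix_(_ < _, _ < _) _.
suff free : row_free (J : 'M_(2, 4)) by apply/eqP: free.
apply: inj_row_free => v vJ.
have vJE j : v ord0 ord0 * mmap f x (Q0 alpha)^`M(j) +
    v ord0 ord_max * mmap f x (Q1 alpha)^`M(j) = 0.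
  have := congr1 (fun M : 'M_(1, 4) => M ord0 j) vJ;
      rewrite !mxE !big_ord_recl big_ord0 addr0 !mxE /= => <-.
  by congr (_ + v _ _ * _); apply: val_inj.
have vJQ j := etrans (congr2 (fun s t => v ord0 ord0 * s + v ord0 ord_max * t)
  (esym (mmap_deriv_Q0 f x j)) (esym (mmap_deriv_Q1 f x j))) (vJE j).
have := vJQ i2; have := vJQ i1; have := vJQ i0; rewrite !neq_ord4 !eqxx /= -/al.
set a := v ord0 ord0; set b := v ord0 ord_max => d0 d1 d2.
have zero2 (c : L) : 2%:R * c = 0 -> c = 0.
  by move/eqP; rewrite mulf_eq0 (negPf two) => /eqP.
have zz (c y : L) : c * y = 0 -> c = 0 \/ y = 0 :> L.
  by move/eqP; rewrite mulf_eq0 => /orP[] /eqP; [left | right].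
have p0 : a * x i0 = 0 by apply/zero2/zero2; rewrite -d0; ring.
have p1 : b * x i1 = 0 by apply/zero2/zero2; rewrite -d1; ring.
have p2 : ((1 + al) * a + (1 - al) * b) * x i2 = 0 by apply/zero2; rewrite -d2; ring.
have nz j l : j != l -> x j = 0 -> x l = 0 -> False.
  by move=> jl xj xl; apply: not_point0 px (two_zeros two a0 a1 aN1 Ex jl xj xl).
suff [va vb] : a = 0 /\ b = 0.
  apply/rowP => j; rewrite !mxE; case: j => [[|[|]]] //= lt_j2.
    by rewrite -[RHS]va; congr (v _ _); apply: val_inj.
  by rewrite -[RHS]vb; congr (v _ _); apply: val_inj.
have [va|x0] := zz _ _ p0.
  split=> //; have [//|x1] := zz _ _ p1.
  move: p2; rewrite va mulr0 add0r => /zz[|x2].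
    by case/zz => // /eqP; rewrite (negPf a1).
  by case: (@nz i1 i2); rewrite ?neq_ord4.
have [vb|x1] := zz _ _ p1; last by case: (@nz i0 i1); rewrite ?neq_ord4.
split=> //; move: p2; rewrite vb mulr0 addr0 => /zz[|x2].
  by case/zz => // /eqP; rewrite (negPf aN1).
by case: (@nz i0 i2); rewrite ?neq_ord4.
Qed.

Lemma curve_homog q : q \in curve_eqns alpha -> exists d, q \is d.-homog.
Proof.
have hX (c : k) (l : 'I_4) : c *: 'X_[U_(l) *+ 2] \is 2.-homog.
  by apply: rpredZ; rewrite dhomogX; apply/eqP; rewrite [LHS]mdegMn mdeg1.
rewrite !inE => /orP[] /eqP ->; exists 2%N.
  rewrite -/(Q0 alpha) -[Q0 alpha]mul1r -mpolyX0 mulX_Q0 !add0m.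
  by rewrite !rpredD ?hX.
rewrite -/(Q1 alpha) -[Q1 alpha]mul1r -mpolyX0 mulX_Q1 !add0m.
by rewrite !rpredD ?hX.
Qed.

Lemma curve_elliptic : quartic_elliptic_curve (sklyanin_curve alpha i).
Proof.
split.
- exact: curve_homog.
- exact: hilbert_curve.
- exact: curve_irreducible.
- exact: curve_smooth.
- apply/on_curveP; split; first by exists i0; rewrite /= /neutral tnth_ord4 unitr1.
  by rewrite /on_quadrics /quadric0 /quadric1 /= /neutral !tnth_ord4; split; ring: im2.
Qed.

Lemma opp_formula_homog : homogeneous [:: opp_formula k].
Proof.
move=> G; rewrite inE => /eqP ->; exists 1%N; apply: ord4_ind;
 by rewrite /opp_formula !tnth_ord4 dhomogX [X in X == _]mdeg1.
Qed.

Lemma tau_formula_homog : homogeneous [:: tau_formula k].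
Proof.
move=> G; rewrite inE => /eqP ->; exists 1%N; apply: ord4_ind;
 by rewrite /tau_formula !tnth_ord4 ?rpredN dhomogX [X in X == _]mdeg1.
Qed.

Definition bihomog d d' (p : mpoly (4 + 4) k) := forall m, m \in msupp p ->
  (\sum_(l < 4) m (lshift 4 l))%N = d /\ (\sum_(l < 4) m (rshift 4 l))%N = d'.

Lemma bihomogD d d' p q : bihomog d d' p -> bihomog d d' q -> bihomog d d' (p + q).
Proof. by move=> hp hq m /msuppD_le; rewrite mem_cat => /orP[/hp|/hq]. Qed.

Lemma bihomogN d d' p : bihomog d d' p -> bihomog d d' (- p).
Proof. by move=> hp m; rewrite (perm_mem (msuppN p)) => /hp. Qed.

Lemma bihomogM d1 d1' d2 d2' p q :
  bihomog d1 d1' p -> bihomog d2 d2' q -> bihomog (d1 + d2) (d1' + d2') (p * q).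
Proof.
move=> hp hq m /msuppM_le /allpairsP[[m1 m2] /= [/hp[e1 e1'] /hq[e2 e2'] ->]].
by rewrite -e1 -e1' -e2 -e2' -!big_split; split; apply: eq_bigr => l _; rewrite mnmDE.
Qed.

Lemma bihomogC c : bihomog 0 0 c%:MP.
Proof.
move=> m; rewrite msuppC; case: ifP => // _; rewrite inE => /eqP ->.
by split; apply: big1 => l _; rewrite mnm0E.
Qed.

Lemma bihomogXl l : bihomog 1 0 'X_(lshift 4 l).
Proof.
move=> m; rewrite msuppX inE => /eqP ->; split.
  by rewrite (bigD1 l) //= mnm1E eqxx big1 // => j /negPf ne; rewrite mnm1E eq_lshift eq_sym ne.
by apply: big1 => j _; rewrite mnm1E eq_lrshift.
Qed.

Lemma bihomogXr l : bihomog 0 1 'X_(rshift 4 l).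
Proof.
move=> m; rewrite msuppX inE => /eqP ->; split.
  by apply: big1 => j _; rewrite mnm1E eq_rlshift.
by rewrite (bigD1 l) //= mnm1E eqxx big1 // => j /negPf ne; rewrite mnm1E eq_rshift eq_sym ne.
Qed.

Lemma add_formula_bihomog : bihomogeneous (group_add (sklyanin_curve alpha i)).
Proof.
move=> G memG; exists 2%N, 2%N; rewrite -/(bihomog 2 2 _).
have {memG} [b ->] : exists b, G = add_formula alpha i b.
  by move: memG; rewrite !inE => /orP[] /eqP ->; [exists true | exists false].
have hXY l l' : bihomog 1 1 ('X_(lshift 4 l) * 'X_(rshift 4 l')).
  exact: (bihomogM (@bihomogXl l) (@bihomogXr l')).
have hC d d' c p : bihomog d d' p -> bihomog d d' (c%:MP * p).
  exact: (bihomogM (@bihomogC c)).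
have h4 x z y t : bihomog 1 1 x -> bihomog 1 1 z -> bihomog 1 1 y -> bihomog 1 1 t ->
    forall j, bihomog 2 2 (tnth (segre alpha%:MP i%:MP (Bipoint x z y t)) j).
  move=> hx hz hy ht; apply: ord4_ind; rewrite /= !tnth_ord4; apply: (@hC).
  - by apply: bihomogD; [apply: (bihomogM hz hy) | apply: (bihomogM hx ht)].
  - by apply: bihomogD; [apply: (bihomogM hz hy) | apply: bihomogN; apply: (bihomogM hx ht)].
  - by apply: bihomogD; [apply: (@hC); apply: (bihomogM hz ht) | apply: (bihomogM hx hy)].
  - by apply: bihomogD; [apply: (@hC); apply: (bihomogM hz ht) | apply: bihomogN;
      apply: (bihomogM hx hy)].
case: b; apply: h4.
- exact: (bihomogD (@hXY _ _) (bihomogN (@hXY _ _))).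
- exact: (bihomogN (bihomogD (@hXY _ _) (@hXY _ _))).
- exact: (bihomogD (@hXY _ _) (@hXY _ _)).
- exact: (bihomogN (bihomogD (@hXY _ _) (@hXY _ _))).
- exact: (bihomogN (@hC _ _ _ _ (bihomogD (@hXY _ _) (bihomogN (@hXY _ _))))).
- exact: (bihomogD (@hXY _ _) (@hXY _ _)).
- exact: (bihomogN (@hC _ _ _ _ (bihomogD (@hXY _ _) (bihomogN (@hXY _ _))))).
- exact: (bihomogD (@hXY _ _) (bihomogN (@hXY _ _))).
Qed.

Lemma curve_group : group_variety (sklyanin_curve alpha i).
Proof.
split; [exact: add_formula_bihomog | exact: opp_formula_homog | move=> L f].
exact: (group_laws f two_neq0 im2 al0 al1 alN1).
Qed.

Lemma curve_translation : translation_by (sklyanin_curve alpha i) (tau_pt i) [:: tau_formula k].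
Proof.
split; last by move=> L f; apply: (translation_law f two_neq0 im2 al0 al1 alN1).
  apply/on_curveP; split; first by exists i0; rewrite /= /tau_pt tnth_ord4 unitr1.
  by rewrite /on_quadrics /quadric0 /quadric1 /= /tau_pt !tnth_ord4; split; ring: im2.
exact: tau_formula_homog.
Qed.

(** Twice the point is (1, 1, -i, -i). *)
Lemma tau_pt_order4 : has_order_4 (sklyanin_curve alpha i) (tau_pt i).
Proof.
have i_neq0 := im_neq0 im2.
have R1 := represents_tau_pt i (idfun : {rmorphism k -> k}) al0.
have v : bip_valid (Bipoint 0 1 1 (-1) : bipoint k).
  by split; right; rewrite /= ?oppr_eq0 oner_eq0.
have R2 : represents alpha i idfun (Bipoint 0 1 1 (-1)) (tnth [tuple 1; 1; - i; - i]).
  split=> //; first by rewrite /=; ring.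
  exists alpha^-1; first by rewrite unitfE invr_neq0.
  by apply: ord4_ind; rewrite /segre_pt /= !tnth_ord4; field.
have Ro := represents_neutral i (idfun : {rmorphism k -> k}) al0.
have add_two x y w p q r := @curve_sum_intro _ alpha i _ idfun two_neq0 im2 al0 al1 alN1 p q r x y w.
exists (tnth [tuple 1; 1; - i; - i]); split.
- by apply: (add_two _ _ _ _ _ _ R1 R1 R2) => -[] _; split=> /=; ring.
- case=> u _ e; have := e i0; have := e i2; rewrite /= /neutral !tnth_ord4 mulr1 => + e0.
  rewrite -e0 mul1r => /eqP; rewrite -subr_eq0 opprK -mulr2n -mulr_natl mulf_eq0.
  by rewrite (negPf two_neq0) (negPf i_neq0).
- by apply: (add_two _ _ _ _ _ _ R2 R2 Ro) => -[] _; split=> /=; ring.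
Qed.

End CurveFacts.

(** * The defining relations as bilinear equations *)

Section Biform.
Variables (k : fieldType) (T : comUnitRingType) (f : {rmorphism k -> T}).
Variables (x y : 'I_4 -> T).
Implicit Types r s : freealg k.

Lemma gen_mul (a b : 'I_4) : gen k a * gen k b = monalg.mkmalgU (word [:: a; b]) 1.
Proof.
rewrite malgM_def fgmulUU mulr1; congr (monalg.mkmalgU _ _).
by apply/eqP; rewrite fmP fmM.
Qed.

Lemma biformD r s : biform f (r + s) x y = biform f r x y + biform f s x y.
Proof.
rewrite /biform -big_split; apply: eq_bigr => a _ /=; rewrite -big_split; apply: eq_bigr =>
    b _ /=.
by rewrite monalg.mcoeffD rmorphD !mulrDl.
Qed.

Lemma biformN r : biform f (- r) x y = - biform f r x y.
Proof.
rewrite /biform -sumrN; apply: eq_bigr => a _ /=; rewrite -sumrN; apply: eq_bigr => b _ /=.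
by rewrite monalg.mcoeffN rmorphN !mulNr.
Qed.

Lemma biformZ c r : biform f (c *: r) x y = f c * biform f r x y.
Proof.
rewrite /biform mulr_sumr; apply: eq_bigr => a _ /=; rewrite mulr_sumr; apply: eq_bigr =>
    b _ /=.
by rewrite monalg.mcoeffZ rmorphM !mulrA.
Qed.

Lemma biform_gen (a b : 'I_4) : biform f (gen k a * gen k b) x y = x a * y b.
Proof.
have wE (c d : 'I_4) : (word [:: a; b] == word [:: c; d]) = (c == a) && (d == b).
  by rewrite fmP /= !eqseq_cons andbT (eq_sym a) (eq_sym b).
rewrite /biform gen_mul (bigD1 a) //= (bigD1 b) //= monalg.mcoeffU wE !eqxx rmorph1 mul1r.
rewrite !big1 ?addr0 // => [c /negPf ne|c /negPf ne]; last first.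
  by rewrite monalg.mcoeffU wE ne andbF rmorph0 !mul0r.
by rewrite big1 // => d _; rewrite monalg.mcoeffU wE ne rmorph0 !mul0r.
Qed.

(** The equations are composed as terms: rewriting would compare products in the free
   algebra up to computation. *)
Lemma biform_comm a b : biform f (comm (gen k a) (gen k b)) x y = x a * y b - x b * y a.
Proof.
exact: etrans (biformD _ _) (congr2 +%R (biform_gen _ _)
  (etrans (biformN _) (congr1 -%R (biform_gen _ _)))).
Qed.

Lemma biform_anti a b : biform f (anti (gen k a) (gen k b)) x y = x a * y b + x b * y a.
Proof. exact: etrans (biformD _ _) (congr2 +%R (biform_gen _ _) (biform_gen _ _)). Qed.

Lemma biform_rel1 c a b a' b' : biform f (comm (gen k a) (gen k b) - c *: anti (gen k a')
    (gen k b')) x y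
  = x a * y b - x b * y a - f c * (x a' * y b' + x b' * y a').
Proof.
exact: etrans (biformD _ _) (congr2 +%R (biform_comm _ _) (etrans (biformN _)
  (congr1 -%R (etrans (biformZ _ _) (congr1 ( *%R (f c)) (biform_anti _ _)))))).
Qed.

Lemma biform_rel2 a b a' b' : biform f (anti (gen k a) (gen k b) - comm (gen k a')
    (gen k b')) x y
  = x a * y b + x b * y a - (x a' * y b' - x b' * y a').
Proof.
exact: etrans (biformD _ _) (congr2 +%R (biform_anti _ _) (etrans (biformN _)
  (congr1 -%R (biform_comm _ _)))).
Qed.

Lemma biform_relations alpha beta gamma :
  (forall r, r \in relations alpha beta gamma -> biform f r x y = 0) <->
  [/\ x i0 * y i1 - x i1 * y i0 = f alpha * (x i2 * y i3 + x i3 * y i2),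
      x i0 * y i2 - x i2 * y i0 = f beta * (x i3 * y i1 + x i1 * y i3) &
      x i0 * y i3 - x i3 * y i0 = f gamma * (x i1 * y i2 + x i2 * y i1)] /\
  [/\ x i0 * y i1 + x i1 * y i0 = x i2 * y i3 - x i3 * y i2,
      x i0 * y i2 + x i2 * y i0 = x i3 * y i1 - x i1 * y i3 &
      x i0 * y i3 + x i3 * y i0 = x i1 * y i2 - x i2 * y i1].
Proof.
rewrite /relations /x0 /x1 /x2 /x3.
split=> [h|[[h1 h2 h3] [h4 h5 h6]]].
  have hd r rs : (forall t, t \in r :: rs -> biform f t x y = 0) ->
      biform f r x y = 0 /\ (forall t, t \in rs -> biform f t x y = 0).
    by move=> H; split=> [|t ts]; apply: H; rewrite inE ?eqxx // ts orbT.
  case/hd: h => [+ /hd[+ /hd[+ /hd[+ /hd[+ /hd[+ _]]]]]].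
  do 3![move/(etrans (esym (biform_rel1 _ _ _ _ _)))/subr0_eq=> ?].
  do 3![move/(etrans (esym (biform_rel2 _ _ _ _)))/subr0_eq=> ?].
  by [].
have cons r rs : biform f r x y = 0 -> (forall t, t \in rs -> biform f t x y = 0) ->
    forall t, t \in r :: rs -> biform f t x y = 0.
  by move=> Hr Hs t; rewrite inE => /orP[/eqP ->|/Hs].
do 3![apply: (@cons); first by apply: (etrans (biform_rel1 _ _ _ _ _)); apply/eqP;
    rewrite subr_eq0; apply/eqP].
do 3![apply: (@cons); first by apply: (etrans (biform_rel2 _ _ _ _)); apply/eqP;
    rewrite subr_eq0; apply/eqP].
by [].
Qed.

End Biform.

(** * Solutions of the bilinear equations over a local ring *)

Section LocalRing.
Variable T : comUnitRingType.
Hypothesis localT : is_local T.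
Implicit Types (s t u al : T).
Local Notation isunit t := (t \is a GRing.unit).

(** In a local ring the nonunits form an ideal. *)
Lemma nonunitD s t : ~~ isunit s -> ~~ isunit t -> ~~ isunit (s + t).
Proof.
move=> ns nt; apply/negP => ust; case: (localT (s / (s + t))).
  by rewrite unitrMl ?unitrV // (negPf ns).
rewrite -[X in X - _](divrr ust) -mulrBl addrC addKr unitrMl ?unitrV //.
by rewrite (negPf nt).
Qed.

Lemma nonunitMl s t : ~~ isunit s -> ~~ isunit (s * t).
Proof. by rewrite unitrM negb_and => ->. Qed.

Lemma nonunitMr s t : ~~ isunit t -> ~~ isunit (s * t).
Proof. by rewrite unitrM negb_and orbC => ->. Qed.

Lemma nonunitN s : ~~ isunit s -> ~~ isunit (- s).
Proof. by rewrite unitrN. Qed.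

Lemma unit_perturb u t : isunit u -> ~~ isunit t -> isunit (u + t).
Proof.
move=> uu nt; apply: contraTT uu => nut; rewrite -(addrK t u).
by apply: nonunitD => //; apply: nonunitN.
Qed.

Lemma unit_cancel u t : isunit u -> u * t = 0 -> t = 0.
Proof. by move=> uu e; apply: (mulrI uu); rewrite e mulr0. Qed.

(** The six relations for beta = 1 and gamma = -1, after adding and subtracting. *)
Definition solved_rels al (x0 x1 x2 x3 y0 y1 y2 y3 : T) :=
  [/\ x0 * y2 = x3 * y1, x2 * y0 = - (x1 * y3), x0 * y3 = - (x2 * y1) & x3 * y0 = x1 * y2] /\
  (2%:R * (x0 * y1) = (1 + al) * (x2 * y3) - (1 - al) * (x3 * y2) /\
   2%:R * (x1 * y0) = (1 - al) * (x2 * y3) - (1 + al) * (x3 * y2)).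

(** Exchanging the first two coordinates, or rotating the last two, replaces alpha by
    - alpha; this reduces the four cases of a unit coordinate to two. *)
Lemma solved_rels_swap al x0 x1 x2 x3 y0 y1 y2 y3 :
  solved_rels al x0 x1 x2 x3 y0 y1 y2 y3 -> solved_rels (- al) x1 x0 x2 x3 y1 y0 y2 y3.
Proof.
by move=> [[e1 e2 e3 e4] [e5 e6]]; split; rewrite ?opprK; split => //; rewrite ?e3 ?e2 ?opprK.
Qed.

Lemma solved_rels_rot al x0 x1 x2 x3 y0 y1 y2 y3 :
  solved_rels al x0 x1 x2 x3 y0 y1 y2 y3 ->
  solved_rels (- al) x0 x1 (- x3) x2 y0 y1 (- y3) y2.
Proof.
move=> [[e1 e2 e3 e4] [e5 e6]]; split; first split.
- by rewrite mulrN e3 opprK.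
- by rewrite mulNr e4.
- by rewrite mulNr opprK.
- by rewrite e2 mulrN.
by rewrite opprK; split; [rewrite e5 | rewrite e6]; ring.
Qed.

(** Let u = y1 / x0.  The monomial equations give y1, y2, y3 as the coordinates of
    u tau(x).  If [u] is a unit, the first quadric vanishes at x; then x2 or x3 is a
    unit, which determines y0.  Otherwise y0 is a unit, and x1 is annihilated by
    2 y0^2 plus a nonunit, so both points are e_0. *)
Lemma rels_unit0 al x0 x1 x2 x3 y0 y1 y2 y3 : isunit (2%:R : T) ->
  solved_rels al x0 x1 x2 x3 y0 y1 y2 y3 -> isunit x0 ->
  [|| isunit y0, isunit y1, isunit y2 | isunit y3] ->
  [/\ x1 = 0, x2 = 0 & x3 = 0] /\ [/\ isunit y0, y1 = 0, y2 = 0 & y3 = 0] \/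
  (exists2 u, isunit u & [/\ y0 = u * x1, y1 = u * x0, y2 = u * x3 & y3 = u * - x2]) /\
  (2%:R * x0 ^+ 2 + (1 + al) * x2 ^+ 2 + (1 - al) * x3 ^+ 2 = 0 /\
   2%:R * x1 ^+ 2 + (1 - al) * x2 ^+ 2 + (1 + al) * x3 ^+ 2 = 0).
Proof.
move=> u2 [[e1 e2 e3 e4] [e5 e6]] ux0 py.
pose u := y1 / x0.
have y1E : y1 = u * x0 by rewrite divrK.
have y2E : y2 = u * x3 by apply: (mulrI ux0); rewrite e1 y1E; ring.
have y3E : y3 = u * - x2 by apply: (mulrI ux0); rewrite e3 y1E; ring.
clearbody u.
have [uu|nu] := boolP (isunit u); [right|left].
  have Q0 : 2%:R * x0 ^+ 2 + (1 + al) * x2 ^+ 2 + (1 - al) * x3 ^+ 2 = 0.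
    apply: (unit_cancel uu); rewrite -[RHS](subrr (2%:R * (x0 * y1))) {2}e5.
    by rewrite y1E y2E y3E; ring.
  have y0E : y0 = u * x1.
    have d2 : x2 * (y0 - u * x1) = 0 by rewrite mulrBr e2 y3E; ring.
    have d3 : x3 * (y0 - u * x1) = 0 by rewrite mulrBr e4 y2E; ring.
    have [ux2|nx2] := boolP (isunit x2); first exact: subr0_eq (unit_cancel ux2 d2).
    have [ux3|nx3] := boolP (isunit x3); first exact: subr0_eq (unit_cancel ux3 d3).
    have : isunit (2%:R * x0 ^+ 2) by rewrite unitrM u2 unitrX.
    have nz : ~~ isunit (- ((1 + al) * x2 ^+ 2 + (1 - al) * x3 ^+ 2)).
      by apply: nonunitN; apply: nonunitD; apply: nonunitMr; apply: nonunitMl.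
    rewrite (_ : 2%:R * _ = - ((1 + al) * x2 ^+ 2 + (1 - al) * x3 ^+ 2)) ?(negPf nz) //.
    by apply/eqP; rewrite -addr_eq0 addrA Q0.
  split; first by exists u.
  split=> //; apply: (unit_cancel uu); rewrite -[RHS](subrr (2%:R * (x1 * y0))) {2}e6.
  by rewrite y0E y2E y3E; ring.
have uy0 : isunit y0.
  move: py; rewrite y1E y2E y3E !unitrM (negPf nu) /= orbF //.
have x10 : x1 = 0.
  apply: (@unit_cancel (2%:R * y0 ^+ 2 + ((1 - al) * y3 ^+ 2 + (1 + al) * y2 ^+ 2))).
    apply: unit_perturb; first by rewrite unitrM u2 unitrX.
    by apply: nonunitD; apply: nonunitMr; rewrite expr2 ?y2E ?y3E; do 2!apply: nonunitMl.
  transitivity (2%:R * (x1 * y0) * y0 - ((1 - al) * (- (x1 * y3) * y3) - (1 + al)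
      * (x1 * y2 * y2))); first by ring.
  by rewrite -e2 -e4 e6; ring.
have x20 : x2 = 0 by apply: (unit_cancel uy0); rewrite mulrC e2 x10 mul0r oppr0.
have x30 : x3 = 0 by apply: (unit_cancel uy0); rewrite mulrC e4 x10 mul0r.
split; split=> //.
- by apply: (unit_cancel ux0); apply: (unit_cancel u2); rewrite e5 x20 x30; ring.
- by rewrite y2E x30 mulr0.
- by rewrite y3E x20 oppr0 mulr0.
Qed.

(** If x0 and x1 are nonunits, then so are y0, y1 and, by eliminating x3 y2 from the
    last two relations, y3.  Hence y2 is a unit and x0, x1 are annihilated by the unit
    x2 y2 + x3 y3. *)
Lemma rels_unit2 al x0 x1 x2 x3 y0 y1 y2 y3 : isunit (2%:R : T) -> isunit al ->
    isunit (1 + al) ->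
  solved_rels al x0 x1 x2 x3 y0 y1 y2 y3 -> ~~ isunit x0 -> ~~ isunit x1 -> isunit x2 ->
  [|| isunit y0, isunit y1, isunit y2 | isunit y3] ->
  [/\ x0 = 0, x1 = 0 & x3 = 0] /\ [/\ y0 = 0, y1 = 0, isunit y2 & y3 = 0].
Proof.
move=> u2 ual u1 [[e1 e2 e3 e4] [e5 e6]] nx0 nx1 ux2 py.
have e56 : 2%:R * 2%:R * al * x2 * y3 = 2%:R * (1 + al) * y1 * x0 - 2%:R * (1 - al) * y0 * x1.
  transitivity ((1 + al) * (2%:R * (x0 * y1)) - (1 - al) * (2%:R * (x1 * y0))); last by ring.
  by rewrite e5 e6; ring.
have uc : isunit (2%:R * 2%:R * al * x2) by rewrite !unitrM u2 ual ux2.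
have ny3 : ~~ isunit y3.
  have : ~~ isunit (2%:R * 2%:R * al * x2 * y3).
    by rewrite e56; apply: nonunitD; [|apply: nonunitN]; apply: nonunitMr.
  by rewrite unitrM negb_and uc.
have ny0 : ~~ isunit y0.
  by have : ~~ isunit (x2 * y0); [rewrite e2; apply/nonunitN/nonunitMl |
      rewrite unitrM negb_and ux2].
have e3' : x2 * y1 = - (x0 * y3) by rewrite e3 opprK.
have ny1 : ~~ isunit y1.
  by have : ~~ isunit (x2 * y1); [rewrite e3'; apply/nonunitN/nonunitMl |
      rewrite unitrM negb_and ux2].
have uy2 : isunit y2 by move: py; rewrite (negPf ny0) (negPf ny1) (negPf ny3) /= orbF.
have ub : isunit (x2 * y2 + x3 * y3).
  by apply: unit_perturb; rewrite ?nonunitMr // unitrM ux2.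
have x00 : x0 = 0.
  apply: (unit_cancel ub); transitivity (x2 * (x0 * y2) - x3 * - (x0 * y3)); first by ring.
  by rewrite -e3' e1; ring.
have x10 : x1 = 0.
  apply: (unit_cancel ub); transitivity (x2 * (x1 * y2) - x3 * - (x1 * y3)); first by ring.
  by rewrite -e2 -e4; ring.
have y00 : y0 = 0 by apply: (unit_cancel ux2); rewrite e2 x10 mul0r oppr0.
have y10 : y1 = 0 by apply: (unit_cancel ux2); rewrite e3' x00 mul0r oppr0.
have y30 : y3 = 0 by apply: (unit_cancel uc); rewrite e56 x00 x10; ring.
split; split=> //; apply: (unit_cancel u1); apply: (unit_cancel uy2).
by transitivity (- (2%:R * (x1 * y0))); [rewrite e6 y30; ring | rewrite x10; ring].
Qed.

End LocalRing.

(** * The scheme Gamma *)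

Section Gamma.
Variables (k : fieldType) (alpha i : k).
Hypotheses (two_neq0 : 2%:R != 0 :> k).
Hypotheses (al0 : alpha != 0) (al1 : 1 - alpha != 0) (alN1 : 1 + alpha != 0).
Variables (T : comUnitRingType) (f : {rmorphism k -> T}).

Lemma unit_rmorph (c : k) : c != 0 -> f c \is a GRing.unit.
Proof. by move=> c0; rewrite rmorph_unit ?unitfE. Qed.

Let al := f alpha.
Let u2 : (2%:R : T) \is a GRing.unit.
Proof. by rewrite -(rmorph_nat f) unit_rmorph. Qed.
Let ual : al \is a GRing.unit. Proof. exact: unit_rmorph. Qed.
Let u1 : 1 + al \is a GRing.unit.
Proof. by rewrite -(rmorph1 f) -rmorphD unit_rmorph. Qed.
Let uN1 : 1 - al \is a GRing.unit.
Proof. by rewrite -(rmorph1 f) -rmorphB unit_rmorph. Qed.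

Lemma biform_solved (x y : 'I_4 -> T) :
  (forall r, r \in relations alpha 1 (-1) -> biform f r x y = 0) <->
  solved_rels al (x i0) (x i1) (x i2) (x i3) (y i0) (y i1) (y i2) (y i3).
Proof.
rewrite biform_relations rmorphN rmorph1 -/al !mul1r mulN1r.
move: (x i0) (x i1) (x i2) (x i3) (y i0) (y i1) (y i2) (y i3) => a0 a1 a2 a3 b0 b1 b2 b3.
split=> [[[h1 h2 h3] [h4 h5 h6]]|[[e1 e2 e3 e4] [e5 e6]]].
  have half (s t : T) : 2%:R * s = 2%:R * t -> s = t by apply: mulrI.
  have add (s t s' t' : T) : s = t -> s' = t' -> s + s' = t + t' by move=> -> ->.
  have sub (s t s' t' : T) : s = t -> s' = t' -> s - s' = t - t' by move=> -> ->.
  split; split.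
  - by apply: half; transitivity ((a0 * b2 - a2 * b0) + (a0 * b2 + a2 * b0));
      [ring | rewrite (add _ _ _ _ h2 h5); ring].
  - by apply: half; transitivity ((a0 * b2 + a2 * b0) - (a0 * b2 - a2 * b0));
      [ring | rewrite (sub _ _ _ _ h5 h2); ring].
  - by apply: half; transitivity ((a0 * b3 - a3 * b0) + (a0 * b3 + a3 * b0));
      [ring | rewrite (add _ _ _ _ h3 h6); ring].
  - by apply: half; transitivity ((a0 * b3 + a3 * b0) - (a0 * b3 - a3 * b0));
      [ring | rewrite (sub _ _ _ _ h6 h3); ring].
  - by transitivity ((a0 * b1 - a1 * b0) + (a0 * b1 + a1 * b0));
      [ring | rewrite (add _ _ _ _ h1 h4); ring].
  - by transitivity ((a0 * b1 + a1 * b0) - (a0 * b1 - a1 * b0));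
      [ring | rewrite (sub _ _ _ _ h4 h1); ring].
split; split.
- apply: (mulrI u2); transitivity (2%:R * (a0 * b1) - 2%:R * (a1 * b0)); first by ring.
  by rewrite e5 e6; ring.
- by rewrite e1 e2; ring.
- by rewrite e3 e4; ring.
- apply: (mulrI u2); transitivity (2%:R * (a0 * b1) + 2%:R * (a1 * b0)); first by ring.
  by rewrite e5 e6; ring.
- by rewrite e1 e2.
- by rewrite e3 e4; ring.
Qed.

Hypothesis localT : is_local T.

Lemma e_point (j : 'I_4) (x : 'I_4 -> T) : x j \is a GRing.unit ->
  (forall l, l != j -> x l = 0) -> same_point (e_ T j) x.
Proof.
move=> uxj x0; exists (x j) => // l; rewrite /e_.
by have [->|/x0->] := eqVneq l j; rewrite ?mulr1 ?mulr0.
Qed.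

Definition tau_vec (x : 'I_4 -> T) := tnth [tuple x i1; x i0; x i3; - x i2].

(** If x0 or x1 is a unit, the point is on the curve or e_0, e_1; if neither is, it is
    e_2 or e_3. *)
Lemma Gamma_split (x y : 'I_4 -> T) : is_point x -> is_point y ->
  solved_rels al (x i0) (x i1) (x i2) (x i3) (y i0) (y i1) (y i2) (y i3) ->
  (exists j, same_point (e_ T j) x /\ same_point (e_ T j) y) \/
  (on_quadrics al x /\ same_point (tau_vec x) y).
Proof.
move=> [jx px] [jy py] R.
have {jy}py : [|| y i0 \is a GRing.unit, y i1 \is a GRing.unit,
    y i2 \is a GRing.unit | y i3 \is a GRing.unit].
  by elim/ord4_ind: jy py => ->; rewrite ?orbT.
have tauP u : u \is a GRing.unit ->
    [/\ y i0 = u * x i1, y i1 = u * x i0, y i2 = u * x i3 & y i3 = u * - x i2] ->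
    same_point (tau_vec x) y.
  by move=> uu [? ? ? ?]; exists u => //; apply: ord4_ind; rewrite /tau_vec !tnth_ord4.
have eP j z : z j \is a GRing.unit -> (forall l, z l = if l == j then z j else 0) ->
    same_point (e_ T j) z.
  by move=> uz h; apply: e_point => // l /negPf ne; rewrite h ne.
have [ux0|nx0] := boolP (x i0 \is a GRing.unit).
  have [[[? ? ?] [? ? ? ?]]|[[u uu ey] Fx]] := rels_unit0 localT u2 R ux0 py; [left|right].
    by exists i0; split; apply: eP => //; apply: ord4_ind; rewrite ?neq_ord4 ?eqxx.
  by split=> //; apply: tauP uu ey.
have [ux1|nx1] := boolP (x i1 \is a GRing.unit).
  have py' : [|| y i1 \is a GRing.unit, y i0 \is a GRing.unit,
      y i2 \is a GRing.unit | y i3 \is a GRing.unit].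
    by rewrite orbCA.
  have [[[? ? ?] [? ? ? ?]]|[[u uu [? ? ? ?]] [F1x F2x]]] :=
      rels_unit0 localT u2 (solved_rels_swap R) ux1 py'; [left|right].
    by exists i1; split; apply: eP => //; apply: ord4_ind; rewrite ?neq_ord4 ?eqxx.
  by rewrite opprK in F1x F2x; split; [split | apply: (tauP u)].
have [ux2|nx2] := boolP (x i2 \is a GRing.unit).
  have [[? ? ?] [? ? ? ?]] := rels_unit2 localT u2 ual u1 R nx0 nx1 ux2 py; left.
  by exists i2; split; apply: eP => //; apply: ord4_ind; rewrite ?neq_ord4 ?eqxx.
have ux3 : x i3 \is a GRing.unit.
  by elim/ord4_ind: jx px => //; rewrite ?(negPf nx0) ?(negPf nx1) ?(negPf nx2).
have py' : [|| y i0 \is a GRing.unit, y i1 \is a GRing.unit,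
    - y i3 \is a GRing.unit | y i2 \is a GRing.unit].
  by rewrite unitrN [X in _ || (_ || X)]orbC.
have [|||[? ? x20] [? ? uy3 ?]] := rels_unit2 localT u2 _ _ (solved_rels_rot R) nx0 nx1 _ py';
  rewrite ?unitrN //.
rewrite unitrN in uy3; left.
by exists i3; split; apply: eP => //; apply: ord4_ind; rewrite ?neq_ord4 ?eqxx.
Qed.

Lemma Gamma_graph (x y : 'I_4 -> T) :
  in_Gamma alpha 1 (-1) f x y <-> in_graph (sklyanin_curve alpha i) [:: tau_formula k] f x y.
Proof.
have vt := value_seq1 y (mmap_tau_formula f x).
split=> [[px py /biform_solved R]|].
  have [|[Ex s]] := Gamma_split px py R; [by left | right].
  split; first by apply/on_curveP.
  apply/vt; split=> //.
  by apply: is_point_same (same_point_sym s) py.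
case=> [[j [[u uu ex] [v uv ey]]]|[/on_curveP[px [h1 h2]] /vt[px' [u uu ey]]]].
  have unit_e : e_ T j j = 1 by rewrite /e_ eqxx.
  split; [by exists j; rewrite ex unit_e mulr1 | by exists j; rewrite ey unit_e mulr1 |].
  apply/biform_solved; rewrite !ex !ey /e_ /solved_rels.
  by elim/ord4_ind: j {unit_e ex ey}; rewrite !neq_ord4 !eqxx /=; split; split; ring.
split=> //; first by apply: is_point_same px'; exists u.
apply/biform_solved; rewrite !ey !tnth_ord4 /solved_rels; split; split; try ring.
  by apply: subr0_eq; transitivity (u * quadric0 al x); [rewrite /quadric0;
      ring | rewrite h1 mulr0].
by apply: subr0_eq; transitivity (u * quadric1 al x); [rewrite /quadric1;
    ring | rewrite h2 mulr0].
Qed.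
End Gamma.

(** * Degrees in the ideal of relations *)

Section FreeAlgebra.
Variables (k : fieldType).
Implicit Types (a b g h : freealg k) (c d : k).

(** Scalars are central although the free algebra is not commutative. *)
Lemma free_scalerAr c g h : g * (c *: h) = c *: (g * h).
Proof.
have comC : g * monalg.mkmalgU (mone : monalg.fmonom 'I_4) c = c *: g.
  rewrite -mul_malgC malgM_def fgmulgU [RHS]malgM_def fgmulUg; apply: eq_bigr => w _.
  by rewrite mulrC mulm1 mul1m.
by rewrite -mul_malgC mulrA comC scalerAl.
Qed.

Section Ideal.
Variable S : seq (freealg k).

Lemma in_ideal0 : in_ideal S 0.
Proof. by exists [::]; split=> //; rewrite big_nil. Qed.

Lemma in_idealD g h : in_ideal S g -> in_ideal S h -> in_ideal S (g + h).
Proof.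
move=> [s [Ss ->]] [t [St ->]]; exists (s ++ t); split; last by rewrite big_cat.
by move=> u; rewrite mem_cat => /orP[/Ss|/St].
Qed.

Lemma in_idealZ c r : r \in S -> in_ideal S (c *: r).
Proof.
move=> rS; exists [:: (c *: 1, r, 1)]; split; first by move=> t; rewrite inE => /eqP ->.
by rewrite big_seq1 /= mulr1 -scalerAl mul1r.
Qed.

(** Multiplying monomials never lowers the degree. *)
Lemma ideal_low_degree n : (forall r, r \in S -> forall w, (fdeg w < n)%N ->
    monalg.mcoeff w r = 0) ->
  forall g, in_ideal S g -> forall w, (fdeg w < n)%N -> monalg.mcoeff w g = 0.
Proof.
move=> low g [s [Ss ->]] w lt_w; rewrite raddf_sum /= big1_seq // => t /andP[_ /Ss tS].
apply/eqP; apply: contraLR lt_w; rewrite monalg.mcoeff_neq0 -leqNgt.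
case/monalg.msuppM_le => w12 [w3 [+ _ ->]]; case/monalg.msuppM_le => w1 [w2 [_ w2r ->]].
rewrite !fdegM; apply: leq_trans (leq_addr _ _); apply: leq_trans (leq_addl _ _).
by rewrite leqNgt; apply/negP => /(low _ tS)/eqP; rewrite monalg.mcoeff_eq0 w2r.
Qed.

End Ideal.

Lemma mcoeff_gen_mul (l m : 'I_4) w : (fdeg w < 2)%N -> monalg.mcoeff w (gen k l * gen k m) = 0.
Proof.
move=> lt_w; rewrite gen_mul monalg.mcoeffU.
by case: eqP lt_w => // <-.
Qed.

Lemma relations_low_degree (alpha beta gamma : k) r : r \in relations alpha beta gamma ->
  forall w, (fdeg w < 2)%N -> monalg.mcoeff w r = 0.
Proof.
move=> + w lt_w; have m0 l m := mcoeff_gen_mul l m lt_w.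
have B g h : monalg.mcoeff w g = 0 -> monalg.mcoeff w h = 0 -> monalg.mcoeff w (g - h) = 0.
  by move=> g0 h0; rewrite monalg.mcoeffB g0 h0 subrr.
have D g h : monalg.mcoeff w g = 0 -> monalg.mcoeff w h = 0 -> monalg.mcoeff w (g + h) = 0.
  by move=> g0 h0; rewrite monalg.mcoeffD g0 h0 addr0.
have c0 l m : monalg.mcoeff w (comm (gen k l) (gen k m)) = 0 := B _ _ (m0 l m) (m0 m l).
have a0 l m : monalg.mcoeff w (anti (gen k l) (gen k m)) = 0 := D _ _ (m0 l m) (m0 m l).
have Z d g : monalg.mcoeff w g = 0 -> monalg.mcoeff w (d *: g) = 0.
  by move=> g0; rewrite monalg.mcoeffZ g0 mulr0.
have h1 d l m l' m' := B _ _ (c0 l m) (Z d _ (a0 l' m')).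
have h2 l m l' m' := B _ _ (a0 l m) (c0 l' m').
rewrite /relations !inE => /or3P[/eqP->|/eqP->|/or4P[] /eqP->];
  [exact: h1 | exact: h1 | exact: h1 | exact: h2 | exact: h2 | exact: h2].
Qed.

End FreeAlgebra.

(** * The generators K, K', Y+, Y- *)

Section LinearIdentities.
Variables (k : fieldType) (V : lmodType k) (W : Type) (coord : W -> V -> k).
Hypothesis coordD : forall w (u v : V), coord w (u + v) = coord w u + coord w v.
Hypothesis coordN : forall w (u : V), coord w (- u) = - coord w u.
Hypothesis coordZ : forall w c (u : V), coord w (c *: u) = c * coord w u.
Hypothesis coord_inj : forall u v : V, (forall w, coord w u = coord w v) -> u = v.
Variables (alpha i : k).
Hypotheses (two_neq0 : 2%:R != 0 :> k) (im2 : i ^+ 2 = -1).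

(** The next three identities are linear in the products p_ab = x_a x_b.  They are stated
    for arbitrary vectors and checked on coordinates; the right-hand sides are the
    combinations of the six defining relations that yield the commutation rules. *)
Lemma KY_linear c d (p01 p10 p02 p20 p03 p30 p12 p21 p13 p31 p23 p32 : V) :
  c ^+ 2 = 1 -> d ^+ 2 = -1 ->
  (p02 + d *: p03 + c *: p12 + (c * d) *: p13)
     - (- (c * d)) *: (p20 + c *: p21 + d *: p30 + (d * c) *: p31) =
  0 *: ((p01 - p10) - alpha *: (p23 + p32)) + (2%:R^-1 * (1 - c * d)) *: ((p02 - p20)
      - 1 *: (p31 + p13))
    + (2%:R^-1 * (d + c)) *: ((p03 - p30) - -1 *: (p12 + p21)) + 0 *: ((p01 + p10)
        - (p23 - p32))
    + (2%:R^-1 * (1 + c * d)) *: ((p02 + p20) - (p31 - p13)) + (2%:R^-1 * (d - c)) *: ((p03 +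
        p30) - (p12 - p21)).
Proof.
move=> c2 d2; have d2' : d * d = -1 by rewrite -expr2.
apply: coord_inj => w; rewrite !(coordD, coordN, coordZ).
by field: c2 d2.
Qed.

Lemma YY_linear (p01 p10 p02 p20 p03 p30 p12 p21 p13 p31 p23 p32 p00 p11 p22 p33 : V) :
  (p22 + (- i) *: p23 + i *: p32 + (i * - i) *: p33) - (p22 + i *: p23 + (- i) *: p32 +
      (- i * i) *: p33)
    - i *: ((p00 + -1 *: p01 + -1 *: p10 + (-1 * -1) *: p11) - (p00 + 1 *: p01 + 1 *: p10 +
        (1 * 1) *: p11)) =
  0 *: ((p01 - p10) - alpha *: (p23 + p32)) + 0 *: ((p02 - p20) - 1 *: (p31 + p13))
    + 0 *: ((p03 - p30) - -1 *: (p12 + p21)) + (2%:R * i) *: ((p01 + p10) - (p23 - p32))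
    + 0 *: ((p02 + p20) - (p31 - p13)) + 0 *: ((p03 + p30) - (p12 - p21)).
Proof.
apply: coord_inj => w; rewrite !(coordD, coordN, coordZ).
by ring.
Qed.

Lemma KK_linear (p01 p10 p02 p20 p03 p30 p12 p21 p13 p31 p23 p32 p00 p11 p22 p33 : V) :
  (p00 + -1 *: p01 + 1 *: p10 + (1 * -1) *: p11) - (p00 + 1 *: p01 + -1 *: p10 + (-1 * 1)
      *: p11)
    - (i * alpha) *: ((p22 + i *: p23 + i *: p32 + (i * i) *: p33) - (p22 + (- i) *: p23 +
        (- i) *: p32 + (- i * - i) *: p33)) =
  - 2%:R *: ((p01 - p10) - alpha *: (p23 + p32)) + 0 *: ((p02 - p20) - 1 *: (p31 + p13))
    + 0 *: ((p03 - p30) - -1 *: (p12 + p21)) + 0 *: ((p01 + p10) - (p23 - p32))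
    + 0 *: ((p02 + p20) - (p31 - p13)) + 0 *: ((p03 + p30) - (p12 - p21)).
Proof.
apply: coord_inj => w; rewrite !(coordD, coordN, coordZ).
by ring: im2.
Qed.

End LinearIdentities.

Section QuantumPlanes.
Variables (k : fieldType) (alpha i : k).
Hypotheses (two_neq0 : 2%:R != 0 :> k) (im2 : i ^+ 2 = -1).
Implicit Types (c d : k).
Local Notation eqA := (eqA alpha 1 (-1)).
Local Notation X0 := (x0 k).
Local Notation X1 := (x1 k).
Local Notation X2 := (x2 k).
Local Notation X3 := (x3 k).

Definition Kel c := X0 + c *: X1.
Definition Yel d := X2 + d *: X3.

Lemma eqA_comb (c1 c2 c3 c4 c5 c6 : k) g h :
  g - h = c1 *: (comm X0 X1 - alpha *: anti X2 X3) + c2 *: (comm X0 X2 - 1 *: anti X3 X1)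
    + c3 *: (comm X0 X3 - -1 *: anti X1 X2) + c4 *: (anti X0 X1 - comm X2 X3)
    + c5 *: (anti X0 X2 - comm X3 X1) + c6 *: (anti X0 X3 - comm X1 X2) ->
  eqA g h.
Proof.
move=> e; rewrite /Defs.eqA e.
have rel c n : (n < 6)%N -> in_ideal (relations alpha 1 (-1))
    (c *: (relations alpha 1 (-1))`_n).
  by move=> lt_n6; apply: in_idealZ; apply: mem_nth.
exact: (in_idealD (in_idealD (in_idealD (in_idealD (in_idealD (rel c1 0%N isT) (rel c2 1%N isT))
  (rel c3 2%N isT)) (rel c4 3%N isT)) (rel c5 4%N isT)) (rel c6 5%N isT)).
Qed.

(** Stated for an abstract algebra, where products cannot unfold to the concrete
    multiplication of the free algebra. *)
Lemma mul_combs (A : lalgType k) (scaleAr : forall c (g h : A), g * (c *: h) = c *: (g * h))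
  c d (g g' h h' : A) :
  (g + c *: g') * (h + d *: h') =
  g * h + d *: (g * h') + c *: (g' * h) + (c * d) *: (g' * h').
Proof. by rewrite mulrDl !mulrDr -!scalerAl !scaleAr scalerA addrA. Qed.

Let mcD w (u v : freealg k) : monalg.mcoeff w (u + v) = monalg.mcoeff w u + monalg.mcoeff w v.
Proof. exact: monalg.mcoeffD. Qed.
Let mcN w (u : freealg k) : monalg.mcoeff w (- u) = - monalg.mcoeff w u.
Proof. exact: monalg.mcoeffN. Qed.
Let mcZ w c (u : freealg k) : monalg.mcoeff w (c *: u) = c * monalg.mcoeff w u.
Proof. exact: monalg.mcoeffZ. Qed.
Let mc_inj (u v : freealg k) : (forall w, monalg.mcoeff w u = monalg.mcoeff w v) -> u = v.
Proof. by move/monalg.malgP. Qed.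

Let expand c d (g g' h h' : freealg k) := @mul_combs (freealg k) (@free_scalerAr k)
    c d g g' h h'.

Lemma KY_commute c d : c ^+ 2 = 1 -> d ^+ 2 = -1 ->
  eqA (Kel c * Yel d) (- (c * d) *: (Yel d * Kel c)).
Proof.
move=> c2 d2.
apply: (@eqA_comb 0 (2%:R^-1 * (1 - c * d)) (2%:R^-1 * (d + c)) 0
  (2%:R^-1 * (1 + c * d)) (2%:R^-1 * (d - c))).
exact: etrans (congr2 (fun u v : freealg k => u - (- (c * d)) *: v) (expand c d X0 X1 X2 X3)
    (expand d c X2 X3 X0 X1))
 (KY_linear mcD mcN mcZ mc_inj alpha two_neq0
  (X0 * X1) (X1 * X0) (X0 * X2) (X2 * X0) (X0 * X3) (X3 * X0)
  (X1 * X2) (X2 * X1) (X1 * X3) (X3 * X1) (X2 * X3) (X3 * X2) c2 d2).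
Qed.

Lemma YY_commute : eqA (comm (Yel i) (Yel (- i))) (i *: (Kel (-1) ^+ 2 - Kel 1 ^+ 2)).
Proof.
apply: (@eqA_comb 0 0 0 (2%:R * i) 0 0).
exact: etrans (congr2 (fun u v : freealg k => u - i *: v)
   (congr2 (fun u v : freealg k => u - v) (expand i (- i) X2 X3 X2 X3) (expand (- i)
       i X2 X3 X2 X3))
   (congr2 (fun u v : freealg k => u - v) (expand (-1) (-1) X0 X1 X0 X1)
       (expand 1 1 X0 X1 X0 X1)))
 (YY_linear mcD mcN mcZ mc_inj alpha i
  (X0 * X1) (X1 * X0) (X0 * X2) (X2 * X0) (X0 * X3) (X3 * X0)
  (X1 * X2) (X2 * X1) (X1 * X3) (X3 * X1) (X2 * X3) (X3 * X2) (X0 * X0) (X1 * X1) (X2 * X2)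
      (X3 * X3)).
Qed.

Lemma KK_commute : eqA (comm (Kel 1) (Kel (-1))) ((i * alpha) *: (Yel i ^+ 2 - Yel (- i) ^+ 2)).
Proof.
apply: (@eqA_comb (- 2%:R) 0 0 0 0 0).
exact: etrans (congr2 (fun u v : freealg k => u - (i * alpha) *: v)
   (congr2 (fun u v : freealg k => u - v) (expand 1 (-1) X0 X1 X0 X1) (expand (-1)
       1 X0 X1 X0 X1))
   (congr2 (fun u v : freealg k => u - v) (expand i i X2 X3 X2 X3) (expand (- i) (- i)
       X2 X3 X2 X3)))
 (KK_linear mcD mcN mcZ mc_inj alpha im2
  (X0 * X1) (X1 * X0) (X0 * X2) (X2 * X0) (X0 * X3) (X3 * X0)
  (X1 * X2) (X2 * X1) (X1 * X3) (X3 * X1) (X2 * X3) (X3 * X2) (X0 * X0) (X1 * X1) (X2 * X2)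
      (X3 * X3)).
Qed.

End QuantumPlanes.

(** * The basis of the degree-one component *)

Section Basis.
Variables (k : fieldType) (i : k).
Hypotheses (two_neq0 : 2%:R != 0 :> k) (im2 : i ^+ 2 = -1).
Variables alpha beta gamma : k.

Definition coef (l : 'I_4) (v : freealg k) := monalg.mcoeff (word [:: l]) v.

Lemma coefD l (u v : freealg k) : coef l (u + v) = coef l u + coef l v.
Proof. exact: monalg.mcoeffD. Qed.
Lemma coefZ l c (u : freealg k) : coef l (c *: u) = c * coef l u.
Proof. exact: monalg.mcoeffZ. Qed.
Lemma coef_gen l m : coef l (gen k m) = (m == l)%:R.
Proof. by rewrite /coef /gen monalg.mcoeffU fmP /= eqseq_cons andbT. Qed.

Lemma degree_oneD (u v : freealg k) : degree_one u -> degree_one v -> degree_one (u + v).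
Proof.
move=> du dv w; rewrite monalg.mcoeffD => nz.
have [u0|/du //] := eqVneq (monalg.mcoeff w u) 0.
by apply: dv; rewrite u0 add0r in nz.
Qed.

Lemma degree_oneZ c (u : freealg k) : degree_one u -> degree_one (c *: u).
Proof. by move=> du w; rewrite monalg.mcoeffZ mulf_eq0 negb_or => /andP[_ /du]. Qed.

Lemma degree_one_gen l : degree_one (gen k l).
Proof. by move=> w; rewrite monalg.mcoeffU; case: (word [:: l] =P w) => [<- //|_];
    rewrite mulr0n eqxx. Qed.

Lemma degree_one_ext (u v : freealg k) : degree_one u -> degree_one v ->
  (forall l, coef l u = coef l v) -> u = v.
Proof.
move=> du dv e; apply/monalg.malgP => w.
have [d1|nd1] := eqVneq (fdeg w) 1%N; last first.
  have z (t : freealg k) : degree_one t -> monalg.mcoeff w t = 0.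
    by move=> dt; apply/eqP; apply: contraNT nd1 => /dt ->.
  by rewrite !z.
case: w d1 => [[|l [|]]] // _; exact: e.
Qed.

(** The relations have degree 2, so A_1 is the space V of generators itself. *)
Lemma coef_ideal g l : in_ideal (relations alpha beta gamma) g -> coef l g = 0.
Proof.
move=> Ig; apply: (@ideal_low_degree _ _ 2 _ _ Ig) => // r rS w;
    exact: relations_low_degree rS w.
Qed.

Lemma sum_ord4 (F : 'I_4 -> freealg k) : \sum_j F j = F i0 + (F i1 + (F i2 + F i3)).
Proof. exact: big_ord4. Qed.

Lemma coef_Kel l c : coef l (Kel c : freealg k) = (i0 == l)%:R + c * (i1 == l)%:R.
Proof.
exact: etrans (coefD _ _ _) (congr2 +%R (coef_gen _ _)
  (etrans (coefZ _ _ _) (congr1 ( *%R c) (coef_gen _ _)))).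
Qed.
Lemma coef_Yel l d : coef l (Yel d : freealg k) = (i2 == l)%:R + d * (i3 == l)%:R.
Proof.
exact: etrans (coefD _ _ _) (congr2 +%R (coef_gen _ _)
  (etrans (coefZ _ _ _) (congr1 ( *%R d) (coef_gen _ _)))).
Qed.

Lemma coef_comb l c0 c1 c2 c3 (u0 u1 u2 u3 : freealg k) :
  coef l (c0 *: u0 + (c1 *: u1 + (c2 *: u2 + c3 *: u3))) =
  c0 * coef l u0 + (c1 * coef l u1 + (c2 * coef l u2 + c3 * coef l u3)).
Proof.
exact: etrans (coefD _ _ _) (congr2 +%R (coefZ _ _ _)
  (etrans (coefD _ _ _) (congr2 +%R (coefZ _ _ _)
  (etrans (coefD _ _ _) (congr2 +%R (coefZ _ _ _) (coefZ _ _ _)))))).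
Qed.

Lemma KY_basis :
  basis_of_A1 alpha beta gamma [tuple Yel i; Yel (- i); Kel 1; Kel (-1)].
Proof.
have dK c : degree_one (Kel c : freealg k).
  by apply: degree_oneD; [|apply: degree_oneZ]; apply: degree_one_gen.
have dY d : degree_one (Yel d : freealg k).
  by apply: degree_oneD; [|apply: degree_oneZ]; apply: degree_one_gen.
split=> [|v dv].
  by apply: ord4_ind; rewrite tnth_ord4; [apply: dY | apply: dY | apply: dK | apply: dK].
set B := [tuple _; _; _; _].
have sumE (c : {ffun 'I_4 -> k}) : \sum_j c j *: tnth B j =
   c i0 *: Yel i + (c i1 *: Yel (- i) + (c i2 *: Kel 1 + c i3 *: Kel (-1))).
  by rewrite sum_ord4 /B !tnth_ord4.
have coefE (c : {ffun 'I_4 -> k}) l : coef l (\sum_j c j *: tnth B j) =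
   c i0 * ((i2 == l)%:R + i * (i3 == l)%:R) + (c i1 * ((i2 == l)%:R + - i * (i3 == l)%:R) +
   (c i2 * ((i0 == l)%:R + 1 * (i1 == l)%:R) + c i3 * ((i0 == l)%:R + - 1 * (i1 == l)%:R))).
  apply: etrans (congr1 (coef l) (sumE c)) _; apply: etrans (coef_comb l _ _ _ _ _ _ _ _) _.
  congr (_ * _ + (_ * _ + (_ * _ + _ * _))).
  - exact: coef_Yel l i.
  - exact: coef_Yel l (- i).
  - exact: coef_Kel l 1.
  - exact: coef_Kel l (-1).
pose c : {ffun 'I_4 -> k} := [ffun j => tnth [tuple (coef i2 v - i * coef i3 v) / 2%:R;
   (coef i2 v + i * coef i3 v) / 2%:R; (coef i0 v + coef i1 v) / 2%:R;
       (coef i0 v - coef i1 v) / 2%:R] j].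
have vE : v = \sum_j c j *: tnth B j.
  apply: degree_one_ext => //.
    rewrite sumE; apply: degree_oneD; first exact/degree_oneZ/dY.
    apply: degree_oneD; first exact/degree_oneZ/dY.
    by apply: degree_oneD; apply: degree_oneZ; apply: dK.
  by apply: ord4_ind; rewrite coefE !ffunE !tnth_ord4 !neq_ord4 !eqxx /=; field: im2.
exists c; split.
  by rewrite /Defs.eqA -vE subrr; apply: in_ideal0.
move=> d Id; apply/ffunP.
have cd l : coef l (\sum_j c j *: tnth B j) = coef l (\sum_j d j *: tnth B j).
  apply: subr0_eq; rewrite -vE; have := coef_ideal l Id.
  by rewrite coefD -scaleN1r coefZ mulN1r.
have i_neq0 := im_neq0 im2.
have two_inj (s t : k) : 2%:R * s = 2%:R * t -> s = t by apply: mulfI.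
have [] : [/\ c i0 = d i0, c i1 = d i1, c i2 = d i2 & c i3 = d i3]; last first.
  by move=> e0 e1 e2 e3; apply: ord4_ind.
have cd' l := etrans (esym (coefE c l)) (etrans (cd l) (coefE d l)).
have := cd' i3; have := cd' i2; have := cd' i1; have := cd' i0.
clear cd cd' Id vE; clearbody c; rewrite !neq_ord4 !eqxx /= !(mulr0, mulr1, mul1r, add0r,
    addr0, mulrN1, mulrN).
rewrite -![_ * i]mulrC -!mulrBr.
move: (c i0) (c i1) (c i2) (c i3) (d i0) (d i1) (d i2) (d i3) => c0 c1 c2 c3 d0 d1 d2 d3.
move=> e0 e1 e2 /(mulfI i_neq0) e3; split; apply: two_inj.
- by transitivity ((c0 + c1) + (c0 - c1)); [ring | rewrite e2 e3; ring].
- by transitivity ((c0 + c1) - (c0 - c1)); [ring | rewrite e2 e3; ring].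
- by transitivity ((c2 + c3) + (c2 - c3)); [ring | rewrite e0 e1; ring].
- by transitivity ((c2 + c3) - (c2 - c3)); [ring | rewrite e0 e1; ring].
Qed.
End Basis.

Theorem proposition5p3 (k : fieldType) (hchar : 2%N \notin [pchar k])
    (i : k) (hi : i ^+ 2 = -1)
    (alpha : k) (hsqrt : exists a : k, a ^+ 2 = alpha)
    (halpha0 : alpha <> 0) (halpha1 : alpha <> 1) (halphaN1 : alpha <> -1) :
  (is_Sklyanin alpha 1 (-1) /\
   exists (C : curve_data k) (tau : local_formulas k 4) (p : 'I_4 -> k),
     [/\ is_A_E_tau alpha 1 (-1) C tau,
         translation_by C p tau
       & has_order_4 C p]) /\
  (exists Yp Ym K K' : freealg k,
     let eqA := eqA alpha 1 (-1) in
     basis_of_A1 alpha 1 (-1) [tuple Yp; Ym; K; K'] /\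
     [/\ eqA (K * Yp) (- i *: (Yp * K)),
         eqA (K * Ym) (i *: (Ym * K)),
         eqA (K' * Yp) (i *: (Yp * K')) &
         eqA (K' * Ym) (- i *: (Ym * K'))] /\
     eqA (comm Yp Ym) (i *: (K' ^+ 2 - K ^+ 2)) /\
     eqA (comm K K') ((i * alpha) *: (Yp ^+ 2 - Ym ^+ 2))).
Proof.
have two_neq0 : 2%:R != 0 :> k by move: hchar; rewrite inE.
have al0 : alpha != 0 by apply/eqP.
have al1 : 1 - alpha != 0 by rewrite subr_eq0 eq_sym; apply/eqP.
have alN1 : 1 + alpha != 0 by rewrite addrC addr_eq0; apply/eqP.
split.
  split; first by rewrite /is_Sklyanin; ring.
  have transl := curve_translation two_neq0 hi al0 al1 alN1.
  exists (sklyanin_curve alpha i), [:: tau_formula k], (tau_pt i); split=> //.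
    split; [exact: curve_elliptic | exact: curve_group | by exists (tau_pt i) |].
    by move=> T f localT x y; apply: Gamma_graph.
  exact: tau_pt_order4.
exists (Yel i), (Yel (- i)), (Kel 1), (Kel (-1)); split; first exact: KY_basis.
have Ni2 : (- i) ^+ 2 = -1 by rewrite sqrrN.
have N1 : (-1) ^+ 2 = 1 :> k by rewrite sqrrN expr1n.
have KY c d e : c ^+ 2 = 1 -> d ^+ 2 = -1 -> e = - (c * d) ->
    eqA alpha 1 (-1) (Kel c * Yel d) (e *: (Yel d * Kel c)).
  by move=> c2 d2 ->; apply: KY_commute.
split; first split.
- by apply: KY; rewrite ?expr1n //; ring.
- by apply: KY; rewrite ?expr1n //; ring.
- by apply: KY; rewrite ?expr1n //; ring.
- by apply: KY; rewrite ?expr1n //; ring.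
by split; [exact: YY_commute | exact: KK_commute].
Qed.
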